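(* Consider the single-client model described in the context, with memory capacity $k$ per class, and let $\delta\in(0,1)$. With probability at least $1-\delta$ over the $N$ observed test samples, for all sufficiently large $N$, $$\epsilon_{\mathrm{post}}\le \epsilon_{\mathrm{asym}}+\mathcal O\!\left(\left(\frac{k+\log\frac1\delta}{N}\right)^{\frac{1}{d+1}}\right).$$ Moreover, if $\epsilon_{\mathrm{asym}}=0$, then with probability at least $1-\delta$, for all sufficiently large $N$, $$\epsilon_{\mathrm{post}}\le \mathcal O\!\left(\left(\frac{k+\log\frac1\delta}{N}\right)^{\frac12}\right).$$ Here the constants hidden in $\mathcal O(\cdot)$ do not depend on $N$, $k$ or $\delta$.
   Context: Fix $d\ge 1$, $\mu\in\mathbb{R}^d$, $w_{\mathrm{pre}}\in\mathbb{R}^d$ with $\|w_{\mathrm{pre}}\|_2=1$, $b_{\mathrm{pre}}\in\mathbb{R}$, and $t>0$. Data model: a label $y$ is uniform on $\{0,1\}$ and, given $y$, the embedding $f\in\mathbb{R}^d$ is uniform on the closed unit ball $S_y=\{f:\|f-(2y-1)\mu\|_2\le 1\}$. Initial classifier: $z(f)=f^\top w_{\mathrm{pre}}+b_{\mathrm{pre}}$, $\hat p_1=1/(1+e^{-t z(f)})$, $\hat p_0=1-\hat p_1$, predicted label $\hat y(f)=\mathbf 1\{z(f)>0\}$, entropy $H(f)=-\hat p_1\log\hat p_1-\hat p_0\log\hat p_0$. For a classifier $h$, $\epsilon(h)=\Pr(h(f)\neq y)$ for a fresh sample; $\epsilon_{\mathrm{pre}}$ is the error rate of $\hat y$. Assumption: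 $\epsilon_{\mathrm{pre}}<1/2$, equivalently $\mu^\top w_{\mathrm{pre}}>0$ and $-\mu^\top w_{\mathrm{pre}}-1<b_{\mathrm{pre}}<\mu^\top w_{\mathrm{pre}}+1$. Memory: the client observes i.i.d. test embeddings $f_1,\dots,f_N$; for $y\in\{0,1\}$ the memory $M_y$ consists of the (at most) $k$ observed embeddings with $\hat y(f_j)=y$ having the smallest entropy. Post-adaptation classifier (the method with hyperparameters $\alpha,\beta\to+\infty$): $h_{\mathrm{post}}(f)$ is the class of the element of $M_0\cup M_1$ nearest to $f$ in Euclidean distance; $\epsilon_{\mathrm{post}}=\epsilon(h_{\mathrm{post}})$ on a fresh test sample. $\epsilon_{\mathrm{asym}}=\epsilon(h_{\mathrm{asym}})$ with $h_{\mathrm{asym}}(f)=\mathbf 1\{f^\top(\mu+w_{\mathrm{pre}})>0\}$. *)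

(* Defs.v *)
From HB Require Import structures.
From mathcomp Require Import all_boot all_order all_algebra.
From mathcomp Require Import all_classical all_reals all_analysis.

Set Implicit Arguments.
Unset Strict Implicit.
Unset Printing Implicit Defensive.

Import Order.TTheory GRing.Theory Num.Theory.
Local Open Scope classical_set_scope.
Local Open Scope ring_scope.

Section Model.
Variable R : realType.

Definition dotp (m : nat) (u v : 'I_m -> R) : R := \sum_(i < m) u i * v i.
Definition enorm (m : nat) (u : 'I_m -> R) : R := Num.sqrt (dotp u u).
Definition edist (m : nat) (u v : 'I_m -> R) : R := enorm (fun i => u i - v i).

Definition vcons (T : Type) (m : nat) (x : T) (v : 'I_m -> T) : 'I_m.+1 -> T :=
  fun i => oapp v x (unlift ord0 i).

(** Iterated integration of g : ('I_m -> T) -> \bar R, each coordinate being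
    integrated by the functional E (x0 is only used to build the unique
    (up to extensionality) family indexed by 'I_0). *)
Fixpoint iter_int (T : Type) (x0 : T) (E : (T -> \bar R) -> \bar R) (m : nat)
  : (('I_m -> T) -> \bar R) -> \bar R :=
  match m return (('I_m -> T) -> \bar R) -> \bar R with
  | 0 => fun g => g (fun _ => x0)
  | m'.+1 => fun g => E (fun x => iter_int x0 E (fun v => g (vcons x v)))
  end.

Definition leb_int (m : nat) (g : ('I_m -> R) -> \bar R) : \bar R :=
  iter_int 0 (fun F => (\int[@lebesgue_measure R]_x F x)%E) g.

Definition cball (m : nat) (c : 'I_m -> R) : set ('I_m -> R) :=
  [set f | edist f c <= 1].

Definition vol_ball (m : nat) : R :=
  fine (leb_int (fun f : 'I_m -> R => (\1_(cball (fun _ => 0)) f)%:E)).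

Definition unif_ball_E (m : nat) (c : 'I_m -> R) (g : ('I_m -> R) -> \bar R)
  : \bar R :=
  (leb_int (fun f => (\1_(cball c) f)%:E * g f) * ((vol_ball m)^-1)%:E)%E.

(** Class centers: S_y is the unit ball around (2y-1) mu. *)
Definition center (m : nat) (mu : 'I_m -> R) (y : bool) : 'I_m -> R :=
  fun i => (2 * (y : nat)%:R - 1) * mu i.

(** Expectation under the marginal law of an embedding f
    (y uniform on {0,1}, f | y uniform on S_y). *)
Definition marg_E (m : nat) (mu : 'I_m -> R) (g : ('I_m -> R) -> \bar R)
  : \bar R :=
  ((2^-1)%:E * (unif_ball_E (center mu false) g + unif_ball_E (center mu true) g))%E.

Definition iid_E (m : nat) (mu : 'I_m -> R) (N : nat)
  (g : ('I_N -> ('I_m -> R)) -> \bar R) : \bar R :=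
  iter_int (fun _ => 0) (marg_E mu) g.

Definition iid_P (m : nat) (mu : 'I_m -> R) (N : nat)
  (A : set ('I_N -> ('I_m -> R))) : \bar R :=
  iid_E mu (fun fs => (\1_A fs)%:E).

Definition err (m : nat) (mu : 'I_m -> R) (h : ('I_m -> R) -> bool) : \bar R :=
  ((2^-1)%:E *
   (unif_ball_E (center mu false) (fun f => (\1_[set f | h f != false] f)%:E)
  + unif_ball_E (center mu true) (fun f => (\1_[set f | h f != true] f)%:E)))%E.

Definition zpre (m : nat) (w : 'I_m -> R) (b : R) (f : 'I_m -> R) : R :=
  dotp f w + b.
Definition p1hat (m : nat) (w : 'I_m -> R) (b t : R) (f : 'I_m -> R) : R :=
  (1 + expR (- (t * zpre w b f)))^-1.
Definition p0hat (m : nat) (w : 'I_m -> R) (b t : R) (f : 'I_m -> R) : R :=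
  1 - p1hat w b t f.
Definition yhat (m : nat) (w : 'I_m -> R) (b : R) (f : 'I_m -> R) : bool :=
  0 < zpre w b f.
Definition entropy (m : nat) (w : 'I_m -> R) (b t : R) (f : 'I_m -> R) : R :=
  - (p1hat w b t f * ln (p1hat w b t f)) - p0hat w b t f * ln (p0hat w b t f).

(** Memory: sample j belongs to M_y iff yhat(f_j) = y and fewer than k samples
    with predicted label y precede it in the order "smaller entropy first,
    ties broken by sample index". So M_y consists of the (at most) k samples
    with predicted label y having the smallest entropy. *)
Definition in_mem (m : nat) (w : 'I_m -> R) (b t : R) (k N : nat)
  (fs : 'I_N -> ('I_m -> R)) (y : bool) (j : 'I_N) : bool :=
  (yhat w b (fs j) == y) &&
  (leq (#|[set i : 'I_N | (yhat w b (fs i) == y) &&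
      ((entropy w b t (fs i) < entropy w b t (fs j)) ||
       ((entropy w b t (fs i) == entropy w b t (fs j)) && (i < j)%N))]|.+1) k).

(** Post-adaptation classifier: class of the nearest memory element
    (ties, and the degenerate case of an empty memory, are resolved to 0). *)
Definition h_post (m : nat) (w : 'I_m -> R) (b t : R) (k N : nat)
  (fs : 'I_N -> ('I_m -> R)) (f : 'I_m -> R) : bool :=
  [exists j : 'I_N, in_mem w b t k fs true j &&
     [forall i : 'I_N, in_mem w b t k fs false i ==>
        (edist f (fs j) < edist f (fs i))]].

Definition eps_post (m : nat) (mu w : 'I_m -> R) (b t : R) (k N : nat)
  (fs : 'I_N -> ('I_m -> R)) : \bar R :=
  err mu (h_post w b t k fs).

Definition h_asym (m : nat) (mu w : 'I_m -> R) (f : 'I_m -> R) : bool :=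
  0 < dotp f (fun i => mu i + w i).

Definition eps_asym (m : nat) (mu w : 'I_m -> R) : \bar R :=
  err mu (h_asym mu w).

End Model.

(* Main.v *)
(** The extreme points of the margin [z] over the two balls are [v = mu + w]
    (maximum) and [- v] (minimum).  A spherical cap of height [r^2] at such a
    point has mass of order [r^(d+1)] and diameter of order [r].  When
    [N r^(d+1)] is of order [k + log (1/delta)], a Chernoff bound puts [k]
    samples in each cap with probability at least [1 - delta]; the memory
    then lies within [O(r)] of [v] and [- v], and the nearest-neighbour
    boundary inside the balls is within [O(r)] of the hyperplane orthogonal
    to [v].  A slab of width [O(r)] has mass [O(r)]; if the asymptotic error
    is zero, the hyperplane misses the interiors of the balls, so only caps of
    height [O(r)] and mass [O(r^((d+1)/2))] can be misclassified.

    The integral of a nonnegative function that is not known to be measurable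
    is a lower integral, which is monotone and superadditive, and additive as
    soon as one summand is measurable.  Caps and slabs are replaced by
    parallelepipeds aligned with all axes but one, whose iterated integrals are
    explicit, so no measurability of the classifiers and no Fubini theorem is
    needed. *)

Require Import Defs.
From HB Require Import structures.
From mathcomp Require Import all_boot all_order all_algebra.
From mathcomp Require Import all_classical all_reals all_analysis.
From mathcomp Require Import measurable_realfun ring lra.

Import Order.TTheory GRing.Theory Num.Theory.
Local Open Scope classical_set_scope.
Local Open Scope ring_scope.

Set Implicit Arguments.
Unset Strict Implicit.

(** * Calculus of lower integrals of nonnegative functions *)

Section LowerIntegral.
Context d (T : measurableType d) (R : realType) (mu : {measure set T -> \bar R}).
Local Open Scope ereal_scope.
Import HBNNSimple.
Implicit Types f g : T -> \bar R.

(** The integral of a nonnegative function is a supremum over the simple functions below it, so an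
    upper bound has to be checked on simple functions only, whether or not [f] is measurable. *)
Lemma lint_le f M : (forall x, 0 <= f x) ->
  (forall h : {nnsfun T >-> R}, (forall x, (h x)%:E <= f x) ->
     \int[mu]_x (h x)%:E <= M) ->
  \int[mu]_x f x <= M.
Proof.
move=> f0 fM; rewrite ge0_integralTE//; apply/ge_ereal_sup => _ [h /= hf <-].
by rewrite -integralT_nnsfun; exact: fM.
Qed.

Lemma lint_mono f g : (forall x, 0 <= f x) -> (forall x, f x <= g x) ->
  \int[mu]_x f x <= \int[mu]_x g x.
Proof.
move=> f0 fg; apply: lint_le => // h hf.
rewrite integralT_nnsfun [leRHS]ge0_integralTE; last first.
  by move=> x; exact: le_trans (fg x).
by apply: ereal_sup_ubound; exists h => //= x; exact: le_trans (fg x).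
Qed.

(** If simple functions [k] and [h] lie below [f] and [g], then [k + h] is simple and lies below
    [f + g]; the two suprema are taken one after the other. *)
Lemma lint_superadd f g : (forall x, 0 <= f x) -> (forall x, 0 <= g x) ->
  \int[mu]_x f x + \int[mu]_x g x <= \int[mu]_x (f x + g x).
Proof.
move=> f0 g0.
have fg0 x : 0 <= f x + g x by exact: adde_ge0.
(* An infinite right-hand side is trivial. Otherwise all integrals involved are finite and can be
   moved across an inequality by subtraction. *)
have [->|fgoo] := eqVneq (\int[mu]_x (f x + g x)) +oo; first by rewrite leey.
have fin (h : {nnsfun T >-> R}) : (forall x, (h x)%:E <= f x + g x) ->
    \int[mu]_x (h x)%:E \is a fin_num.
  move=> hfg; rewrite ge0_fin_numE; last first.
    by apply: integral_ge0 => x _; rewrite lee_fin.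
  apply: (@le_lt_trans _ _ (\int[mu]_x (f x + g x))); last by rewrite ltey.
  by apply: lint_mono => // x; rewrite lee_fin.
have fin_int : \int[mu]_x (f x + g x) \is a fin_num.
  by rewrite ge0_fin_numE ?ltey//; apply: integral_ge0.
have step (h : {nnsfun T >-> R}) : (forall x, (h x)%:E <= g x) ->
    \int[mu]_x f x <= \int[mu]_x (f x + g x) - \int[mu]_x (h x)%:E.
  move=> hg; apply: lint_le => // k kf.
  rewrite leeBrDr; last by apply: fin => x; rewrite (le_trans (hg x))// leeDr.
  rewrite -ge0_integralD//; first last.
  - exact/measurable_EFinP.
  - by move=> x _; rewrite lee_fin.
  - exact/measurable_EFinP.
  - by move=> x _; rewrite lee_fin.
  by apply: lint_mono => x; [rewrite adde_ge0// lee_fin|rewrite leeD].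
have int_f : \int[mu]_x f x \is a fin_num.
  rewrite ge0_fin_numE; last exact: integral_ge0.
  apply: (@le_lt_trans _ _ (\int[mu]_x (f x + g x))); last by rewrite ltey.
  by apply: lint_mono => // x; rewrite leeDl.
rewrite addeC -leeBrDr//; apply: lint_le => // h hg.
rewrite leeBrDr// addeC -leeBrDr; first exact: step.
by apply: fin => x; rewrite (le_trans (hg x))// leeDr.
Qed.

(** For a simple [h] below [f + g], measurability of [g] makes the positive part of [h - g]
    measurable; it lies below [f], and added to [g] it dominates [h]. *)
Lemma lint_subadd f g : (forall x, 0 <= f x) -> (forall x, 0 <= g x) ->
  measurable_fun setT g ->
  \int[mu]_x (f x + g x) <= \int[mu]_x f x + \int[mu]_x g x.
Proof.
move=> f0 g0 mg; apply: lint_le => [x|h hfg]; first exact: adde_ge0.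
pose k x := maxe ((h x)%:E - g x) 0.
have mk : measurable_fun setT k.
  apply: measurable_maxe => //; apply: emeasurable_funB => //.
  exact/measurable_EFinP.
have k0 x : 0 <= k x by rewrite /k le_max lexx orbT.
apply: (@le_trans _ _ (\int[mu]_x (k x + g x))).
  apply: lint_mono => x; first by rewrite lee_fin.
  rewrite /k; have := g0 x; case: (g x) => [r| |]//= _.
    by rewrite -leeBlDr// le_max lexx.
  by rewrite max_r ?leNye// add0e leey.
rewrite ge0_integralD//; apply: leeD => //.
apply: lint_mono => // x; rewrite /k ge_max f0 andbT.
have := hfg x; have := g0 x; case: (g x) => [r _ ?|_ _|//].
  by rewrite leeBlDr.
by rewrite leNye.
Qed.

Lemma lint_scale_le f (c : R) : (0 <= c)%R -> (forall x, 0 <= f x) ->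
  c%:E * \int[mu]_x f x <= \int[mu]_x (c%:E * f x).
Proof.
rewrite le_eqVlt => /predU1P[<- _|c0 f0].
  by rewrite mul0e; apply: integral_ge0 => x _; rewrite mul0e.
rewrite muleC -lee_pdivlMr//; apply: lint_le => // h hf.
rewrite lee_pdivlMr// muleC -ge0_integralZl_EFin//.
- apply: lint_mono => x; first by rewrite mule_ge0// lee_fin// ltW.
  by apply: lee_wpmul2l => //; rewrite lee_fin ltW.
- by move=> x _; rewrite lee_fin.
- exact/measurable_EFinP.
- exact: ltW.
Qed.

End LowerIntegral.

(** * Translations and intervals on the real line *)

Section LebesgueLine.
Context (R : realType).
Local Notation mu := (@lebesgue_measure R).
Local Open Scope ereal_scope.

Lemma measurable_shift (c : R) :
  measurable_fun setT (fun x : measurableTypeR R => (x + c)%R : measurableTypeR R).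
Proof. by apply: measurable_funD => //; exact: measurable_cst. Qed.

(** The pushforward is a measure that gives half-open intervals their length, and these values
    determine Lebesgue measure. *)
Lemma lebesgue_measure_shift (c : R) (A : set R) : measurable A ->
  pushforward mu (fun x : measurableTypeR R => (x + c)%R : measurableTypeR R) A
  = mu A.
Proof.
pose phi : {mfun measurableTypeR R >-> measurableTypeR R} :=
  HB.pack (fun x : measurableTypeR R => (x + c)%R : measurableTypeR R)
    (isMeasurableFun.Build _ _ _ _ _ (measurable_shift c)).
move=> mA; apply/esym.
apply: (@lebesgue_measure_unique _ (pushforward mu phi)) => //= _ [[a b]] _ <-.
rewrite /pushforward /= (_ : _ @^-1` _ = [set` `](a - c)%R, (b - c)%R]]).
  by rewrite !lebesgue_measure_itv/= !lte_fin ltrD2r -!EFinB opprB addrA subrK.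
by apply/seteqP; split=> x /=; rewrite !in_itv/= ltrBlDr lerBrDr.
Qed.

Import HBNNSimple.

Lemma lint_shift (f : R -> \bar R) (c : R) : (forall x, 0 <= f x) ->
  \int[mu]_x f (x + c)%R = \int[mu]_x f x.
Proof.
(* One inequality for all nonnegative functions and all shifts suffices: the reverse one is its
   instance for the shifted function and [- c]. *)
have H g (e : R) : (forall x, 0 <= g x) -> \int[mu]_x g x <= \int[mu]_x g (x + e)%R.
  move=> g0; apply: lint_le => // h hg.
  have mh : measurable_fun setT (fun x => (h x)%:E) by exact/measurable_EFinP.
  rewrite (_ : \int[mu]_x (h x)%:E = \int[mu]_x (h (x + e)%R)%:E).
    by apply: lint_mono => x //; rewrite lee_fin.
  rewrite -(@ge0_integral_pushforward _ _ (measurableTypeR R) (measurableTypeR R) R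
    _ (measurable_shift e) mu setT (fun x => (h x)%:E))//; last first.
    by move=> x _; rewrite lee_fin.
  apply: eq_measure_integral; first exact: measurable_shift.
  by move=> mphi A mA _; exact/esym/lebesgue_measure_shift.
move=> f0; apply/eqP; rewrite eq_le (H f c)// andbT.
have {2}-> : f = (fun x => f (x - c + c)%R) by apply/funext => x; rewrite subrK.
exact: (H (fun x => f (x + c)%R) (- c)%R).
Qed.

Lemma lint_itv (c a b : R) : (0 <= c)%R -> (a <= b)%R ->
  \int[mu]_x (c * (a <= x <= b)%R%:R)%:E = (c * (b - a))%:E.
Proof.
move=> c0 ab; under eq_integral do rewrite EFinM.
rewrite (_ : (fun x => _) = fun x => c%:E * (\1_(`[a, b]%classic) x)%:E); last first.
  by apply/funext => x; rewrite indicE mem_setE in_itv.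
rewrite ge0_integralZl_EFin//; last exact/measurable_EFinP/measurable_indic.
rewrite integral_indic//= setIT lebesgue_measure_itv/= lte_fin.
case: ltP => // ba; have -> : a = b by apply: le_anti; rewrite ab ba.
by rewrite mule0 subrr mulr0.
Qed.

End LebesgueLine.

(** * Iterated integrals and volumes of boxes and parallelepipeds *)

Section IteratedIntegral.
Context (R : realType).
Local Notation mu := (@lebesgue_measure R).
Implicit Types m : nat.

Lemma vcons0 T m (x : T) (v : 'I_m -> T) : vcons x v ord0 = x.
Proof. by rewrite /vcons unlift_none. Qed.

Lemma vconsS T m (x : T) (v : 'I_m -> T) i : vcons x v (lift ord0 i) = v i.
Proof. by rewrite /vcons liftK. Qed.

Lemma vcons_comp T U m (g : 'I_m.+1 -> T -> U) (x : T) (v : 'I_m -> T) :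
  (fun i => g i (vcons x v i)) =
  vcons (g ord0 x) (fun i => g (lift ord0 i) (v i)).
Proof.
by apply/funext => i; case: (unliftP ord0 i) => [j|] ->; rewrite ?vcons0 ?vconsS.
Qed.

Lemma forall_ordS m (P : pred 'I_m.+1) :
  [forall j, P j] = P ord0 && [forall j : 'I_m, P (lift ord0 j)].
Proof.
apply/forallP/andP => [H|[H0 /forallP H] j].
  by split; [exact: H|apply/forallP => j; exact: H].
by case: (unliftP ord0 j) => [k|] ->.
Qed.

Lemma dotp_vcons m (x : R) (v : 'I_m -> R) n :
  dotp (vcons x v) n = x * n ord0 + dotp v (fun i => n (lift ord0 i)).
Proof.
rewrite /dotp big_ord_recl vcons0; congr (_ + _).
by apply: eq_bigr => i _; rewrite vconsS.
Qed.

Local Open Scope ereal_scope.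

Lemma lebi_ge0 m (g : ('I_m -> R) -> \bar R) : (forall f, 0 <= g f) ->
  0 <= leb_int g.
Proof.
elim: m g => [|m IH] g g0; first exact: g0.
by apply: integral_ge0 => x _; exact: IH.
Qed.

Lemma lebi_mono m (g1 g2 : ('I_m -> R) -> \bar R) : (forall f, 0 <= g1 f) ->
  (forall f, g1 f <= g2 f) -> leb_int g1 <= leb_int g2.
Proof.
elim: m g1 g2 => [|m IH] g1 g2 g0 g12; first exact: g12.
by apply: lint_mono => x; [exact: lebi_ge0|exact: IH].
Qed.

Lemma lebi0 m : @leb_int R m (fun=> 0) = 0.
Proof.
elim: m => [//|m IH]; rewrite /leb_int /=.
rewrite -[RHS](integral0 mu setT); apply: eq_integral => x _; exact: IH.
Qed.

Lemma lebi_superadd m (g1 g2 : ('I_m -> R) -> \bar R) : (forall f, 0 <= g1 f) ->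
  (forall f, 0 <= g2 f) ->
  leb_int g1 + leb_int g2 <= leb_int (fun f => g1 f + g2 f).
Proof.
elim: m g1 g2 => [|m IH] g1 g2 g10 g20; first exact: lexx.
apply: le_trans.
  by apply: lint_superadd => x; exact: lebi_ge0.
by apply: lint_mono => x; [rewrite adde_ge0//; exact: lebi_ge0|exact: IH].
Qed.

Lemma lebi_scale_le m (g : ('I_m -> R) -> \bar R) (c : R) : (0 <= c)%R ->
  (forall f, 0 <= g f) -> c%:E * leb_int g <= leb_int (fun f => c%:E * g f).
Proof.
move=> c0; elim: m g => [|m IH] g g0; first exact: lexx.
apply: le_trans; first by apply: lint_scale_le => // x; exact: lebi_ge0.
apply: lint_mono => x; last exact: IH.
by rewrite mule_ge0//; exact: lebi_ge0.
Qed.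

Lemma lebi_shift m (g : ('I_m -> R) -> \bar R) (c : 'I_m -> R) :
  (forall f, 0 <= g f) -> leb_int (fun f => g (fun i => (f i + c i)%R)) = leb_int g.
Proof.
elim: m g c => [|m IH] g c g0.
  by rewrite /leb_int/=; congr (g _); apply/funext; case.
rewrite /leb_int /= -[RHS](lint_shift (c ord0)); last first.
  by move=> x; exact: lebi_ge0.
apply: eq_integral => x _.
rewrite -[RHS](IH _ (fun i => c (lift ord0 i)))//.
congr (iter_int _ _ _); apply/funext => v.
by rewrite (@vcons_comp _ _ _ (fun i y => (y + c i)%R)).
Qed.

(** All partial integrals are measurable, which is what subadditivity of the
    (lower) integral needs. *)
Fixpoint sec_measurable m : (('I_m -> R) -> \bar R) -> Prop :=
  match m return (('I_m -> R) -> \bar R) -> Prop with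
  | 0%N => fun=> True
  | m'.+1 => fun g =>
      measurable_fun setT (fun x : R => leb_int (fun v => g (vcons x v))) /\
      forall x, sec_measurable (fun v => g (vcons x v))
  end.

Lemma sec_measurable0 m : @sec_measurable m (fun=> 0).
Proof. by elim: m => [|m IH] //; split. Qed.

Lemma lebi_subadd m (g1 g2 : ('I_m -> R) -> \bar R) : (forall f, 0 <= g1 f) ->
  (forall f, 0 <= g2 f) -> sec_measurable g2 ->
  leb_int (fun f => g1 f + g2 f) <= leb_int g1 + leb_int g2.
Proof.
elim: m g1 g2 => [|m IH] g1 g2 g10 g20; first by move=> _; exact: lexx.
move=> [mg2 sg2]; apply: le_trans; last first.
  by apply: lint_subadd => // x; exact: lebi_ge0.
apply: lint_mono => x; last by apply: IH => //; exact: sg2.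
by apply: lebi_ge0 => f; rewrite adde_ge0.
Qed.

(** In the volume computations below, integrating out all coordinates but the first leaves a
    constant times the indicator of an interval; measurability and the value of the full integral
    both follow from this form. *)
Let sec_measurableS m (g : ('I_m.+1 -> R) -> \bar R) (c a b : R) :
  (forall x, leb_int (fun v => g (vcons x v)) = (c * (a <= x <= b)%R%:R)%:E) ->
  (forall x, sec_measurable (fun v => g (vcons x v))) ->
  sec_measurable g.
Proof.
move=> gE mg; split => //.
rewrite (_ : (fun _ => _) = EFin \o (fun x => (c * \1_(`[a, b]%classic) x)%R)).
  apply/measurable_EFinP; apply: measurable_funM => //.
by apply/funext => x /=; rewrite gE indicE mem_setE in_itv.
Qed.

Let leb_intS m (g : ('I_m.+1 -> R) -> \bar R) (c a b : R) :
  (forall x, leb_int (fun v => g (vcons x v)) = (c * (a <= x <= b)%R%:R)%:E) ->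
  (0 <= c)%R -> (a <= b)%R -> leb_int g = (c * (b - a))%:E.
Proof.
by move=> gE c0 ab; rewrite -lint_itv//; apply: eq_integral => x _; exact: gE.
Qed.

Definition in_box m (a : 'I_m -> R) (h : R) (f : 'I_m -> R) : bool :=
  [forall j, (a j - h <= f j <= a j + h)%R].

Lemma in_box_vcons m (a : 'I_m.+1 -> R) h x (v : 'I_m -> R) :
  in_box a h (vcons x v) =
  (a ord0 - h <= x <= a ord0 + h)%R && in_box (fun j => a (lift ord0 j)) h v.
Proof.
rewrite /in_box forall_ordS vcons0; congr (_ && _).
by apply: eq_forallb => j; rewrite vconsS.
Qed.

Lemma box_volume m (a : 'I_m -> R) (h : R) : (0 <= h)%R ->
  leb_int (fun f => (in_box a h f)%:R%:E) = ((2 * h) ^+ m)%:E /\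
  sec_measurable (fun f => (in_box a h f)%:R%:E).
Proof.
move=> h0; elim: m a => [|m IH] a.
  split=> //; rewrite /leb_int/= expr0 (_ : in_box _ _ _ = true)//.
  by apply/forallP; case.
have [IH1 IH2] := IH (fun j => a (lift ord0 j)).
have gE x : leb_int (fun v => (in_box a h (vcons x v))%:R%:E) =
    ((2 * h) ^+ m * (a ord0 - h <= x <= a ord0 + h)%R%:R)%:E.
  under eq_fun do rewrite in_box_vcons.
  by case: (_ <= _ <= _)%R => /=; rewrite ?mulr1 ?mulr0//; exact: lebi0.
split.
  rewrite (leb_intS gE) ?exprn_ge0 ?mulr_ge0//; last by lra.
  by rewrite exprSr; congr ((_ * _)%:E); ring.
apply: (sec_measurableS gE) => x; under eq_fun do rewrite in_box_vcons.
by case: (_ <= _ <= _)%R => //=; exact: sec_measurable0.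
Qed.

(** When [n i] is nonzero this is a parallelepiped: the constraint on coordinate [i] is traded for
    one on the linear form [dotp f n], which fits caps and slabs orthogonal to [n] without rotating
    coordinates. *)
Definition in_slab m (i : 'I_m) (n a : 'I_m -> R) (h al be : R) (f : 'I_m -> R) :=
  [forall j, (j != i) ==> (a j - h <= f j <= a j + h)%R] &&
  (al <= dotp f n <= be)%R.

Lemma in_slab_vconsS m (i : 'I_m) n a h al be x (v : 'I_m -> R) :
  in_slab (lift ord0 i) n a h al be (vcons x v) =
  (a ord0 - h <= x <= a ord0 + h)%R &&
  in_slab i (fun j => n (lift ord0 j)) (fun j => a (lift ord0 j)) h
    (al - x * n ord0)%R (be - x * n ord0)%R v.
Proof.
rewrite /in_slab forall_ordS vcons0 dotp_vcons -andbA /=; congr (_ && _).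
congr (_ && _).
  by apply: eq_forallb => j; rewrite vconsS (inj_eq lift_inj).
by rewrite !(lerBlDl, lerBrDl).
Qed.

Lemma in_slab_vcons0 m n a h al be x (v : 'I_m -> R) :
  (forall j, n (lift ord0 j) = 0%R) ->
  in_slab ord0 n a h al be (vcons x v) =
  (al <= x * n ord0 <= be)%R && in_box (fun j => a (lift ord0 j)) h v.
Proof.
move=> n0; rewrite /in_slab forall_ordS /= dotp_vcons andbC; congr (_ && _).
  by rewrite /dotp big1 ?addr0// => j _; rewrite n0 mulr0.
by apply: eq_forallb => j; rewrite vconsS.
Qed.

(** [i] is the last index with [n i != 0]: the coordinates integrated after it
    are then free of the constraint on [dotp f n], and those integrated before
    it only translate that constraint. *)
Lemma slab_volume m (n : 'I_m -> R) : (exists i, n i != 0%R) ->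
  exists i (kappa : R), [/\ n i != 0%R, (0 < kappa)%R &
   forall (a : 'I_m -> R) (h al be : R), (0 <= h)%R -> (al <= be)%R ->
   leb_int (fun f => (in_slab i n a h al be f)%:R%:E) =
     (kappa * h ^+ m.-1 * (be - al))%:E /\
   sec_measurable (fun f => (in_slab i n a h al be f)%:R%:E)].
Proof.
elim: m n => [|m IH] n; first by case; case.
have [/IH[i [kappa [ni kappa0 H]]] _|n0 [k nk]] :=
    pselect (exists i, n (lift ord0 i) != 0%R).
  exists (lift ord0 i), (2 * kappa)%R; split=> [//||a h al be h0 albe].
    by rewrite mulr_gt0.
  have gE x : leb_int (fun v =>
      (in_slab (lift ord0 i) n a h al be (vcons x v))%:R%:E) =
      (kappa * h ^+ m.-1 * (be - al) * (a ord0 - h <= x <= a ord0 + h)%R%:R)%:E.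
    under eq_fun do rewrite in_slab_vconsS.
    case: (_ <= _ <= _)%R => /=; rewrite ?mulr1 ?mulr0; last exact: lebi0.
    rewrite (H _ _ _ _ h0 _).1 ?lerD2r//.
    by congr ((_ * _)%:E); ring.
  split.
    rewrite (leb_intS gE); last 2 first.
    - by rewrite !mulr_ge0 ?exprn_ge0 ?subr_ge0// ltW.
    - by lra.
    (* This needs [0 < m], which the existence of [i : 'I_m] provides. *)
    have -> : (h ^+ m.+1.-1 = h * h ^+ m.-1)%R.
      by rewrite -exprS prednK// (leq_ltn_trans _ (ltn_ord i)).
    by congr (_%:E); ring.
  apply: (sec_measurableS gE) => x; under eq_fun do rewrite in_slab_vconsS.
  case: (_ <= _ <= _)%R => /=; last exact: sec_measurable0.
  by apply: (H _ _ _ _ h0 _).2; rewrite lerD2r.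
have nS j : n (lift ord0 j) = 0%R.
  by apply/eqP/negPn/negP => nj; apply: n0; exists j.
have n0N0 : n ord0 != 0%R.
  by move: nk; case: (unliftP ord0 k) => [j|] ->//; rewrite nS eqxx.
exists ord0, (2 ^+ m / `|n ord0|)%R; split=> [//||a h al be h0 albe].
  by rewrite divr_gt0 ?exprn_gt0// normr_gt0.
have [p [q [pq itvE qpE]]] : exists p q : R, [/\ (p <= q)%R,
    forall x, (al <= x * n ord0 <= be)%R = (p <= x <= q)%R &
    (q - p = (be - al) / `|n ord0|)%R].
  case/orP: (lt_total n0N0) => nlt.
    exists (be / n ord0)%R, (al / n ord0)%R; split.
    - by rewrite ler_ndivrMr// divfK.
    - by move=> x; rewrite ler_ndivlMr// ler_ndivrMr// andbC.
    - by rewrite ltr0_norm//; field.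
  exists (al / n ord0)%R, (be / n ord0)%R; split.
  - by rewrite ler_pdivrMr// divfK.
  - by move=> x; rewrite ler_pdivlMr// ler_pdivrMr.
  - by rewrite gtr0_norm//; field.
have [bE mb] := box_volume (fun j => a (lift ord0 j)) h0.
have gE x : leb_int (fun v => (in_slab ord0 n a h al be (vcons x v))%:R%:E) =
    ((2 * h) ^+ m * (p <= x <= q)%R%:R)%:E.
  under eq_fun do rewrite (in_slab_vcons0 _ _ _ _ _ _ nS) itvE.
  by case: (_ <= _ <= _)%R => /=; rewrite ?mulr1 ?mulr0//; exact: lebi0.
split.
  rewrite (leb_intS gE)// ?exprn_ge0 ?mulr_ge0// qpE exprMn/=.
  by congr (_%:E); ring.
apply: (sec_measurableS gE) => x.
under eq_fun do rewrite (in_slab_vcons0 _ _ _ _ _ _ nS) itvE.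
by case: (_ <= _ <= _)%R => //=; exact: sec_measurable0.
Qed.

End IteratedIntegral.

(** * Euclidean geometry of unit balls and their caps *)

Section Euclid.
Context (R : realType) (m : nat).
Implicit Types u v f g c : 'I_m -> R.

Lemma dotpC u v : dotp u v = dotp v u.
Proof. by apply: eq_bigr => i _; rewrite mulrC. Qed.

Lemma dotpDl u v f : dotp (fun i => u i + v i) f = dotp u f + dotp v f.
Proof. by rewrite /dotp -big_split; apply: eq_bigr => i _; rewrite mulrDl. Qed.

Lemma dotpZl a u f : dotp (fun i => a * u i) f = a * dotp u f.
Proof. by rewrite /dotp mulr_sumr; apply: eq_bigr => i _; rewrite mulrA. Qed.

Lemma dotpNl u f : dotp (fun i => - u i) f = - dotp u f.
Proof. by rewrite /dotp -sumrN; apply: eq_bigr => i _; rewrite mulNr. Qed.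

Lemma dotpBl u v f : dotp (fun i => u i - v i) f = dotp u f - dotp v f.
Proof. by rewrite (dotpDl u (fun i => - v i)) dotpNl. Qed.

Lemma dotpDr u v f : dotp f (fun i => u i + v i) = dotp f u + dotp f v.
Proof. by rewrite dotpC dotpDl !(dotpC f). Qed.

Lemma dotpZr a u f : dotp f (fun i => a * u i) = a * dotp f u.
Proof. by rewrite dotpC dotpZl !(dotpC f). Qed.

Lemma dotpNr u f : dotp f (fun i => - u i) = - dotp f u.
Proof. by rewrite dotpC dotpNl !(dotpC f). Qed.

Lemma dotpBr u v f : dotp f (fun i => u i - v i) = dotp f u - dotp f v.
Proof. by rewrite dotpC dotpBl !(dotpC f). Qed.

Lemma dotp_ge0 u : 0 <= dotp u u.
Proof. by apply: sumr_ge0 => i _; exact: sqr_ge0. Qed.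

Lemma sqr_coord_le u i : u i ^+ 2 <= dotp u u.
Proof.
rewrite /dotp (bigD1 i)//= -expr2 lerDl; apply: sumr_ge0 => j _.
exact: sqr_ge0.
Qed.

Lemma enorm_ge0 u : 0 <= enorm u.
Proof. exact: sqrtr_ge0. Qed.

Lemma sqr_enorm u : enorm u ^+ 2 = dotp u u.
Proof. by rewrite sqr_sqrtr// dotp_ge0. Qed.

Lemma dotp_sqrB u v :
  dotp (fun i => u i - v i) (fun i => u i - v i) =
  dotp u u - 2 * dotp u v + dotp v v.
Proof. by rewrite dotpBl !dotpBr (dotpC v u); ring. Qed.

Lemma dotp_sqrD u v :
  dotp (fun i => u i + v i) (fun i => u i + v i) =
  dotp u u + 2 * dotp u v + dotp v v.
Proof. by rewrite dotpDl !dotpDr (dotpC v u); ring. Qed.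

Lemma enorm_eq0 u : enorm u = 0 -> forall i, u i = 0.
Proof.
move=> u0 i; apply/eqP; rewrite -sqrf_eq0; apply/eqP/le_anti.
by rewrite sqr_ge0 andbT (le_trans (sqr_coord_le u i))// -sqr_enorm u0 expr0n.
Qed.

Lemma dotp_le_enorm u v : dotp u v <= enorm u * enorm v.
Proof.
have [u0|uN0] := eqVneq (enorm u) 0.
  rewrite u0 mul0r /dotp big1// => i _.
  by rewrite (enorm_eq0 u0) mul0r.
have [v0|vN0] := eqVneq (enorm v) 0.
  rewrite v0 mulr0 /dotp big1// => i _.
  by rewrite (enorm_eq0 v0) mulr0.
have ab : 0 < enorm u * enorm v by rewrite mulr_gt0 ?lt_def ?uN0 ?vN0 ?enorm_ge0.
(* The expanded square is [2 |u| |v| (|u| |v| - dotp u v)], and [|u| |v|] is positive here. *)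
have := dotp_ge0 (fun i => enorm v * u i - enorm u * v i).
rewrite (dotp_sqrB (fun i => enorm v * u i)) !dotpZl !dotpZr -!sqr_enorm.
rewrite (_ : _ + _ = 2 * (enorm u * enorm v) * (enorm u * enorm v - dotp u v));
  last by ring.
by rewrite pmulr_rge0 ?subr_ge0// mulr_gt0.
Qed.

Lemma enormD u v : enorm (fun i => u i + v i) <= enorm u + enorm v.
Proof.
rewrite -(@ler_pXn2r _ 2)// ?nnegrE ?addr_ge0 ?enorm_ge0//.
rewrite sqr_enorm dotp_sqrD sqrrD !sqr_enorm lerD2r lerD2l.
by have := dotp_le_enorm u v; lra.
Qed.

Lemma euclid_sym f g : Defs.edist f g = Defs.edist g f.
Proof. by congr Num.sqrt; apply: eq_bigr => i _; ring. Qed.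

Lemma euclid_triangle f g c :
  Defs.edist f g <= Defs.edist f c + Defs.edist c g.
Proof.
apply: le_trans (enormD _ _); rewrite le_eqVlt; apply/orP; left; apply/eqP.
by congr enorm; apply/funext => i; ring.
Qed.

Lemma cballP c f :
  cball c f <-> dotp (fun i => f i - c i) (fun i => f i - c i) <= 1.
Proof. by rewrite -sqr_enorm expr_le1 ?enorm_ge0. Qed.

(** AM-GM form of Cauchy-Schwarz for a unit direction. *)
Lemma cball_dotp_le c f u : dotp u u = 1 -> cball c f ->
  dotp f u <= dotp c u + 1.
Proof.
move=> u1 /cballP fc; have := dotp_ge0 (fun i => (f i - c i) - u i).
rewrite (dotp_sqrB (fun i => f i - c i)) (dotpBl f c u) u1; lra.
Qed.

(** Expanding around the apex [c + u], the square is [|f - c|^2 - 2 dotp (f - c) u + 1 <= 2 - 2 (1 -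
    s)]. *)
Lemma cball_sqr_dist c f u s : dotp u u = 1 -> cball c f ->
  dotp c u + 1 - s <= dotp f u ->
  dotp (fun i => f i - (c i + u i)) (fun i => f i - (c i + u i)) <= 2 * s.
Proof.
move=> u1 /cballP fc fs.
rewrite (_ : (fun i => _) = fun i => (f i - c i) - u i); last first.
  by apply/funext => i; ring.
by rewrite (dotp_sqrB (fun i => f i - c i)) (dotpBl f c u) u1; lra.
Qed.

(** With [e = f - (c + u)] one has [|f - c|^2 = |e|^2 + 2 dotp e u + 1], and the slab forces
    [dotp e u <= - r^2 / 2]; so [f] is in the ball once [|e| <= r]. *)
Lemma in_slab_cball i u : dotp u u = 1 -> u i != 0 ->
  exists eta r0 : R, [/\ 0 < eta, 0 < r0 &
    forall c r f, 0 < r <= r0 ->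
    in_slab i u (fun j => c j + u j) (eta * r) (dotp c u + 1 - r ^+ 2)
      (dotp c u + 1 - r ^+ 2 / 2) f -> cball c f].
Proof.
move=> u1 ui.
have m0 : (0 < m)%N by rewrite (leq_ltn_trans _ (ltn_ord i)).
have D1 : 1 <= m%:R :> R by rewrite ler1n.
have a0 : 0 < `|u i| by rewrite normr_gt0.
have uj j : `|u j| <= 1.
  by rewrite -(@expr_le1 _ 2)// real_normK ?num_real// -u1 sqr_coord_le.
(* With this [eta] the coordinates other than [i] contribute at most [|u i| r / 4] to [dotp e u] and
   [r^2 / 16] to [|e|^2]; since [r <= |u i| / 2] gives [r^2 <= |u i| r / 2], it follows that
   [|e i| <= 3 r / 4]. *)
exists (`|u i| / (4 * m%:R)), (`|u i| / 2); split.
- by rewrite divr_gt0// mulr_gt0// (lt_le_trans _ D1).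
- by rewrite divr_gt0.
move=> c r f /andP[r0 rle] /andP[/forallP box /andP[lo hi]]; apply/cballP.
set eta := `|u i| / (4 * m%:R) in box.
have etam : eta * m%:R = `|u i| / 4 by rewrite /eta; field; lra.
have eta0 : 0 < eta by rewrite divr_gt0// mulr_gt0// (lt_le_trans _ D1).
pose e j := f j - c j - u j.
have ej j : j != i -> `|e j| <= eta * r.
  by move=> ji; have := box j; rewrite ji /= ler_norml /e => /andP[? ?]; lra.
have eu : dotp e u = dotp f u - dotp c u - 1.
  by rewrite /e (dotpBl (fun i => f i - c i)) dotpBl u1.
have sum_le (F : 'I_m -> R) b : (forall j, j != i -> F j <= b) -> 0 <= b ->
    \sum_(j < m | j != i) F j <= m%:R * b.
  move=> Fb b0; apply: (@le_trans _ _ (\sum_(j < m) b)).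
    rewrite [leRHS](bigID (fun j => j != i))/=.
    apply: (@le_trans _ _ (\sum_(j < m | j != i) b)); first exact: ler_sum.
    by rewrite lerDl sumr_ge0.
  by rewrite sumr_const card_ord mulr_natl.
have ei : `|e i| * `|u i| <= r ^+ 2 + `|u i| / 4 * r.
  rewrite -normrM; have -> : e i * u i = dotp e u - \sum_(j < m | j != i) e j * u j.
    by rewrite /dotp [in RHS](bigD1 i)//= addrK.
  apply: (le_trans (ler_normB _ _)); apply: lerD.
    by rewrite eu ler_norml; apply/andP; split; nra.
  apply: (le_trans (ler_norm_sum _ _ _)).
  have -> : `|u i| / 4 * r = m%:R * (eta * r) by rewrite -etam; ring.
  apply: sum_le => [j ji|]; last by rewrite mulr_ge0// ltW.
  by rewrite normrM -[leRHS]mulr1; apply: ler_pM => //; exact: ej.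
have ei2 : `|e i| <= 3 / 4 * r.
  rewrite -(ler_pM2r a0); apply: (le_trans ei); nra.
have ee : dotp e e <= r ^+ 2.
  rewrite /dotp (bigD1 i)//=.
  have h1 : e i * e i <= 9 / 16 * r ^+ 2.
    rewrite -expr2 -(real_normK (num_real (e i))).
    have := normr_ge0 (e i); nra.
  have h2 : \sum_(j < m | j != i) e j * e j <= m%:R * (eta * r) ^+ 2.
    apply: sum_le => [j /ej ejr|]; last exact: sqr_ge0.
    by rewrite -expr2 -(real_normK (num_real (e j))) ler_pXn2r// nnegrE mulr_ge0// ltW.
  have h3 : m%:R * (eta * r) ^+ 2 <= 1 / 16 * r ^+ 2.
    rewrite exprMn mulrA ler_wpM2r ?sqr_ge0//.
    have eta1 : eta * m%:R <= 1 / 4 by rewrite etam; have := uj i; lra.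
    nra.
  have := sqr_ge0 r; lra.
rewrite (_ : (fun i => f i - c i) = fun i => e i + u i); last first.
  by apply/funext => j; rewrite /e; ring.
by rewrite dotp_sqrD u1 eu; lra.
Qed.

End Euclid.

(** * Mass of caps and slabs under the uniform law on a ball *)

Section BallMass.
Context (R : realType) (m : nat).
Implicit Types u v f c : 'I_m -> R.
Implicit Types g : ('I_m -> R) -> \bar R.
Local Notation V := (vol_ball R m).
Local Notation vol A := (leb_int (fun f : 'I_m -> R => (A f)%:R%:E)).

Lemma unit_coord u : dotp u u = 1 -> exists i, u i != 0.
Proof.
move=> u1; apply: contrapT => /forallNP u0.
have := oner_neq0 R; rewrite -u1 /dotp big1 ?eqxx// => i _.
by have /negP/negPn/eqP -> := u0 i; rewrite mul0r.
Qed.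

(** [A] is a parallelepiped inscribed in the cap of height [r^2]: half-widths of order [r] in
    [m - 1] directions and thickness [r^2 / 2] along [u], whence the exponent [m + 1]. *)
Lemma cap_volume u : dotp u u = 1 ->
  exists kappa r0 : R, [/\ 0 < kappa, 0 < r0 &
  forall c r, 0 < r <= r0 -> exists A : ('I_m -> R) -> bool,
    (forall f, A f -> cball c f /\ dotp c u + 1 - r ^+ 2 <= dotp f u) /\
    vol A = (kappa * r ^+ m.+1)%:E].
Proof.
move=> u1; have [i [kappa [ui kappa0 H]]] := slab_volume (unit_coord u1).
have [eta [r0 [eta0 r00 sub]]] := in_slab_cball u1 ui.
exists (kappa * eta ^+ m.-1 / 2), r0; split=> //.
  by rewrite divr_gt0// mulr_gt0// exprn_gt0.
move=> c r /andP[rp rle].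
exists (in_slab i u (fun j => c j + u j) (eta * r) (dotp c u + 1 - r ^+ 2)
      (dotp c u + 1 - r ^+ 2 / 2)); split.
  move=> f fA; split; first by apply: (sub c r f _ fA); rewrite rp.
  by move/andP: fA => [_ /andP[]].
have r2 := sqr_ge0 r.
rewrite (H _ _ _ _ _ _).1; last 2 first.
- by rewrite mulr_ge0// ltW.
- by lra.
have m0 : (0 < m)%N by rewrite (leq_ltn_trans _ (ltn_ord i)).
rewrite exprMn (_ : r ^+ m.+1 = r ^+ m.-1 * r ^+ 2); last first.
  by rewrite -exprD addn2 prednK.
by congr (_%:E); field.
Qed.

Local Open Scope ereal_scope.

Lemma indic_ge0 (A : set ('I_m -> R)) f : 0 <= (\1_A f : R)%:E.
Proof. by rewrite lee_fin indicE ler0n. Qed.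

Lemma leb_cball_shift c :
  leb_int (fun f => (\1_(cball c) f : R)%:E) =
  leb_int (fun f => (\1_(cball (fun=> 0%R)) f : R)%:E).
Proof.
rewrite -[LHS](lebi_shift c); last exact: indic_ge0.
congr leb_int; apply/funext => f; congr (_%:E).
rewrite !indicE; congr (_%:R); congr (nat_of_bool _); apply/idP/idP; rewrite !inE.
  by move/cballP => H; apply/cballP; apply: le_trans H; rewrite le_eqVlt; apply/orP; left;
    apply/eqP; apply: eq_bigr => i _; ring.
by move/cballP => H; apply/cballP; apply: le_trans H; rewrite le_eqVlt; apply/orP; left;
  apply/eqP; apply: eq_bigr => i _; ring.
Qed.

Section UnitVector.
Variables (w : 'I_m -> R) (w1 : dotp w w = 1%R).

(** [vol_ball] is a [fine] value used as a divisor, so the integral must be finite and positive. The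
    ball contains one parallelepiped and lies in another, of half-width 1. *)
Lemma leb_cball_bounds : exists a b : R, (0 < a)%R /\
  a%:E <= leb_int (fun f => (\1_(cball (fun=> 0%R)) f : R)%:E) <= b%:E.
Proof.
have [kappa [r0 [kappa0 r00 H]]] := cap_volume w1.
have [A [AB AE]] := H (fun=> 0%R) r0 (ltac:(by rewrite r00/=)).
have [i [kappa' [_ kappa'0 H']]] := slab_volume (unit_coord w1).
exists (kappa * r0 ^+ m.+1)%R, (kappa' * 1 ^+ m.-1 * (1 - (- 1)))%R; split.
  by rewrite mulr_gt0// exprn_gt0.
rewrite -AE -(H' (fun=> 0%R) 1%R (- 1)%R 1%R ler01 (ltac:(lra))).1.
apply/andP; split; apply: lebi_mono => f; rewrite ?lee_fin ?indicE//.
  case: (boolP (A f)) => // /AB[fB _].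
  by rewrite mem_set.
rewrite ler_nat; case: (boolP (f \in _)) => //; rewrite inE => fB.
suff -> : in_slab i w (fun=> 0%R) 1 (-1)%R 1 f by [].
have fw : (dotp f w <= 1)%R.
  have := cball_dotp_le w1 fB; have -> : dotp (fun=> 0%R) w = 0%R.
    by apply: big1 => j _; rewrite mul0r.
  by rewrite add0r.
have fw' : (- 1 <= dotp f w)%R.
  have w1' : dotp (fun j => - w j)%R (fun j => - w j)%R = 1%R.
    by rewrite dotpNl dotpNr opprK.
  have := cball_dotp_le w1' fB; rewrite !dotpNr.
  have -> : dotp (fun=> 0%R) w = 0%R.
    by apply: big1 => j _; rewrite mul0r.
  by lra.
rewrite /in_slab fw fw' !andbT; apply/forallP => j; apply/implyP => _.
have /cballP H1 := fB.
rewrite sub0r add0r -ler_norml -(@expr_le1 _ 2)// real_normK ?num_real//.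
apply: le_trans H1; apply: le_trans (sqr_coord_le _ j).
by rewrite subr0.
Qed.

Lemma leb_cball c : leb_int (fun f => (\1_(cball c) f : R)%:E) = V%:E.
Proof.
rewrite leb_cball_shift /vol_ball fineK//.
have [a [b [a0 /andP[_ lb]]]] := leb_cball_bounds.
rewrite ge0_fin_numE; first by apply: le_lt_trans lb _; rewrite ltry.
by apply: lebi_ge0 => f; exact: indic_ge0.
Qed.

Lemma vol_ball_gt0 : (0 < V)%R.
Proof.
have [a [b [a0 /andP[la _]]]] := leb_cball_bounds.
by move: la; rewrite leb_cball lee_fin; exact: lt_le_trans.
Qed.

Let iV0 : 0 <= (V^-1)%:E.
Proof. by rewrite lee_fin invr_ge0 ltW// vol_ball_gt0. Qed.

Lemma unif_ball_ge0 c g : (forall f, 0 <= g f) -> 0 <= unif_ball_E c g.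
Proof.
move=> g0; apply: mule_ge0 => //; apply: lebi_ge0 => f.
by rewrite mule_ge0// indic_ge0.
Qed.

(** On the ball, [g] dominates [k0] plus [a - k0] times the indicator of [A]; superadditivity does
    the rest for an arbitrary nonnegative [g]. *)
Lemma unif_ball_ge c g (A : ('I_m -> R) -> bool) (k0 a vA : R) :
  (forall f, 0 <= g f) -> (0 <= k0 <= a)%R ->
  (forall f, A f -> cball c f) ->
  (forall f, cball c f -> k0%:E <= g f) ->
  (forall f, A f -> a%:E <= g f) ->
  vol A = vA%:E ->
  (k0 + (a - k0) * (vA / V))%:E <= unif_ball_E c g.
Proof.
move=> g0 /andP[k00 ka] Ac gk ga AE.
have V0 := vol_ball_gt0.
rewrite (_ : _ + _ = (k0 * V + (a - k0) * vA) * V^-1)%R; last first.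
  by field; rewrite gt_eqF.
rewrite EFinM; apply: lee_wpmul2r => //.
rewrite EFinD !EFinM -(leb_cball c) -AE.
apply: le_trans.
  apply: leeD.
    by apply: lebi_scale_le => // f; exact: indic_ge0.
  by apply: lebi_scale_le => [|f]; rewrite ?subr_ge0// lee_fin ler0n.
apply: le_trans.
  apply: lebi_superadd => f; by apply: mule_ge0; rewrite ?indic_ge0// lee_fin ?subr_ge0.
apply: lebi_mono => f.
  by apply: adde_ge0; apply: mule_ge0; rewrite ?indic_ge0// lee_fin ?subr_ge0.
rewrite indicE; case: (boolP (f \in _)) => fc.
  rewrite mul1e -!EFinM -EFinD; rewrite inE in fc.
  case: (boolP (A f)) => fA.
    by rewrite !mulr1 addrC subrK; exact: ga.
  by rewrite mulr1 mulr0 addr0; exact: gk.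
rewrite mul0e mule0 add0e; case: (boolP (A f)) => fA; last by rewrite mule0.
by move: fc; rewrite mem_set//; exact: Ac.
Qed.

(** The indicator of [A] is the summand with measurable partial integrals, so subadditivity applies
    to otherwise arbitrary nonnegative [g] and [g1]. *)
Lemma unif_ball_le c g1 g (A : ('I_m -> R) -> bool) (vA : R) :
  (forall f, 0 <= g1 f) -> (forall f, 0 <= g f) ->
  sec_measurable (fun f => (A f)%:R%:E : \bar R) -> vol A = vA%:E ->
  (forall f, cball c f -> g f <= g1 f + (A f)%:R%:E) ->
  unif_ball_E c g <= unif_ball_E c g1 + (vA / V)%:E.
Proof.
move=> g10 g0 mA AE gA.
have h0 f : 0 <= (\1_(cball c) f)%:E * g1 f by rewrite mule_ge0// indic_ge0.
rewrite /unif_ball_E EFinM -ge0_muleDl; last 2 first.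
- exact: lebi_ge0.
- by rewrite -AE; apply: lebi_ge0 => f; rewrite lee_fin.
apply: lee_wpmul2r => //; rewrite -AE.
apply: le_trans; last by apply: lebi_subadd => // f; rewrite lee_fin.
apply: lebi_mono => f; first by rewrite mule_ge0// indic_ge0.
rewrite indicE; case: (boolP (f \in _)) => fc.
  by rewrite !mul1e; apply: gA; rewrite inE in fc.
by rewrite !mul0e add0e lee_fin.
Qed.

End UnitVector.

(** A cap of height [s] lies within [sqrt (2 s)] of its apex, hence in a parallelepiped of
    half-width [sqrt (2 s)] and thickness [s] along [u]. *)
Lemma unif_cap_le u : dotp u u = 1%R -> exists K : R, (0 <= K)%R /\
  forall c s g, (0 <= s)%R -> (forall f, 0 <= g f <= 1) ->
  (forall f, cball c f -> (dotp f u < dotp c u + 1 - s)%R -> g f = 0) ->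
  unif_ball_E c g <= (K * Num.sqrt s ^+ m.+1)%:E.
Proof.
move=> u1; have V0 := vol_ball_gt0 u1.
have [i [kappa [ui kappa0 H]]] := slab_volume (unit_coord u1).
have m0 : (0 < m)%N by rewrite (leq_ltn_trans _ (ltn_ord i)).
exists (kappa * Num.sqrt 2 ^+ m.-1 / V)%R; split.
  by rewrite divr_ge0 ?mulr_ge0 ?exprn_ge0 ?sqrtr_ge0// ltW.
move=> c s g s0 g01 gcap.
have [AE mA] := H (fun j => c j + u j)%R (Num.sqrt (2 * s)%R)
  (dotp c u + 1 - s)%R (dotp c u + 1)%R (sqrtr_ge0 _) (ltac:(lra)).
have g0 f : 0 <= g f by case/andP: (g01 f).
apply: (@le_trans _ _ (unif_ball_E c (fun=> 0) +
    (kappa * Num.sqrt (2 * s) ^+ m.-1 * (dotp c u + 1 - (dotp c u + 1 - s)) / V)%R%:E)).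
  apply: (unif_ball_le u1 _ _ mA AE) => //.
  move=> f fc; rewrite add0e.
  have [fs|fs] := ltP (dotp f u) (dotp c u + 1 - s)%R.
    by rewrite gcap// lee_fin.
  rewrite [in leRHS](_ : in_slab _ _ _ _ _ _ _ = true); first by case/andP: (g01 f).
  apply/andP; split; last by rewrite fs (cball_dotp_le u1 fc).
  apply/forallP => j; apply/implyP => _.
  rewrite -ler_distl; rewrite -sqrtr_sqr ler_wsqrtr//.
  apply: le_trans (cball_sqr_dist u1 fc fs).
  exact: (sqr_coord_le (fun j => f j - (c j + u j))%R j).
rewrite [unif_ball_E _ _](_ : _ = 0); last first.
  rewrite /unif_ball_E; under eq_fun do rewrite mule0.
  by rewrite lebi0 mul0e.
rewrite add0e lee_fin sqrtrM// exprMn.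
rewrite (_ : Num.sqrt s ^+ m.+1 = Num.sqrt s ^+ m.-1 * s)%R; last first.
  by rewrite -{3}(sqr_sqrtr s0) -exprD addn2 prednK.
by rewrite le_eqVlt; apply/orP; left; apply/eqP; ring.
Qed.

(** The part of the ball where [|dotp f v| <= rho] fits into a parallelepiped of half-width 1 whose
    volume is linear in [rho]; on the rest of the ball [g1] dominates [g]. *)
Lemma unif_slab_le (w v : 'I_m -> R) : dotp w w = 1%R -> (exists i, v i != 0%R) ->
  exists K : R, (0 <= K)%R /\
  forall c rho g1 g, (0 <= rho)%R -> (forall f, 0 <= g1 f) -> (forall f, 0 <= g f <= 1) ->
  (forall f, cball c f -> (rho < `|dotp f v|)%R -> g f <= g1 f) ->
  unif_ball_E c g <= unif_ball_E c g1 + (K * rho)%:E.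
Proof.
move=> w1 vN0; have V0 := vol_ball_gt0 w1.
have [i [kappa [vi kappa0 H]]] := slab_volume vN0.
exists (kappa * 2 / V)%R; split; first by rewrite divr_ge0 ?mulr_ge0// ltW.
move=> c rho g1 g rho0 g10 g01 gg.
have [AE mA] := H c 1%R (- rho)%R rho ler01 (ltac:(lra)).
have g0 f : 0 <= g f by case/andP: (g01 f).
rewrite (_ : kappa * 2 / V * rho = kappa * 1 ^+ m.-1 * (rho - - rho) / V)%R; last first.
  by rewrite expr1n; ring.
apply: (unif_ball_le w1 _ _ mA AE) => // f fc.
have [rf|fr] := ltP rho `|dotp f v|%R.
  by rewrite -[leLHS]adde0 leeD ?gg// lee_fin.
rewrite [in leRHS](_ : in_slab _ _ _ _ _ _ _ = true).
  by rewrite -[leLHS]add0e leeD//; case/andP: (g01 f).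
rewrite /in_slab -ler_norml fr andbT; apply/forallP => j; apply/implyP => _.
rewrite -ler_distl -(@expr_le1 _ 2)// real_normK ?num_real//.
move/cballP: fc; apply: le_trans.
exact: (sqr_coord_le (fun j => f j - c j)%R j).
Qed.

End BallMass.

(** * Chernoff bound for two simultaneous counts *)

Section TwoCounts.
Context (R : realType) (T : Type) (x0 : T) (E : (T -> \bar R) -> \bar R).
Variables (S A B : T -> bool) (p : R).
Hypotheses (AS : forall f, A f -> S f) (BS : forall f, B f -> S f).
Hypothesis p01 : 0 <= p <= 2^-1.
Hypothesis E_ge0 : forall q, (forall f, (0 <= q f)%E) -> (0 <= E q)%E.
(** What a superadditive functional retains of the law of total expectation: a base level on the
    support [S], raised on two events [A] and [B] of mass at least [p] each. *)
Hypothesis E_ge : forall (q : T -> \bar R) (a b c : R),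
  (forall f, (0 <= q f)%E) -> 0 <= c -> c <= a -> c <= b ->
  (forall f, S f -> (c%:E <= q f)%E) -> (forall f, A f -> (a%:E <= q f)%E) ->
  (forall f, B f -> (b%:E <= q f)%E) ->
  ((c + (a - c) * p + (b - c) * p)%:E <= E q)%E.

Definition counts (i j N : nat) (fs : 'I_N -> T) : bool :=
  [&& [forall s, S (fs s)], (i <= \sum_(s < N) A (fs s))%N &
    (j <= \sum_(s < N) B (fs s))%N].

Lemma counts_vcons i j i' j' N f (fs : 'I_N -> T) : S f ->
  (i <= A f + i')%N -> (j <= B f + j')%N ->
  counts i' j' fs -> counts i j (vcons f fs).
Proof.
move=> Sf ii jj /and3P[/forallP all ci cj].
rewrite /counts forall_ordS !big_ord_recl !vcons0 Sf /=.
under eq_forallb do rewrite vconsS.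
under eq_bigr do rewrite vconsS.
under [X in _ && (_ <= _ + X)%N]eq_bigr do rewrite vconsS.
apply/and3P; split; first exact/forallP.
  by rewrite (leq_trans ii)// leq_add2l.
by rewrite (leq_trans jj)// leq_add2l.
Qed.

(** A bound on the probability that a binomial [(N, p)] count is below [i], by Markov's inequality
    for [2 ^ (- count)], whose mean is [(1 - p / 2) ^ N]. No count is below 0. *)
Let tail (N i : nat) : R := if i is 0 then 0 else 2 ^+ i * (1 - p / 2) ^+ N.

Let p2 : 0 <= 1 - p / 2.
Proof. by case/andP: p01 => *; lra. Qed.

Let tail_pred N i : tail N i.-1 <= tail N i.
Proof.
case: i => [|[|i]]//=; first by rewrite mulr_ge0 ?exprn_ge0.
by rewrite [2 ^+ i.+2]exprS -mulrA ler_peMl ?ler1n ?mulr_ge0 ?exprn_ge0.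
Qed.

(** This is conditioning on the first trial; the factor [1 - p / 2] arises as [(1 - p) + p / 2]. *)
Let tail_step N i : (1 - p) * tail N i + p * tail N i.-1 <= tail N.+1 i.
Proof.
case/andP: p01 => p0 _; case: i => [|i]; first by rewrite /tail/= !mulr0 addr0.
have X0 : 0 <= (1 - p / 2) ^+ N by rewrite exprn_ge0.
have : tail N i <= 2 ^+ i * (1 - p / 2) ^+ N.
  by case: i => //=; rewrite mulr_ge0// exprn_ge0.
move=> /(ler_wpM2l p0).
have -> : tail N i.+1 = 2 * 2 ^+ i * (1 - p / 2) ^+ N by rewrite /tail exprS.
have -> : tail N.+1 i.+1 = 2 * 2 ^+ i * ((1 - p / 2) * (1 - p / 2) ^+ N).
  by rewrite /tail !exprS.
by rewrite [i.+1.-1]/=; lra.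
Qed.

(** Induction on the number of samples: a first sample in [A] lowers the demand [i] by one, one in
    [B] lowers [j], and a union bound over the two shortfalls is carried along. *)
Lemma iter_int_counts N i j (g : ('I_N -> T) -> \bar R) :
  (forall fs, (0 <= g fs)%E) -> (forall fs, counts i j fs -> (1 <= g fs)%E) ->
  ((Num.max 0 (1 - tail N i - tail N j))%:E <= iter_int x0 E g)%E.
Proof.
have iter_ge0 n (h : ('I_n -> T) -> \bar R) :
    (forall fs, (0 <= h fs)%E) -> (0 <= iter_int x0 E h)%E.
  by elim: n h => [|n IH] h h0 /=; [exact: h0|apply: E_ge0 => f; exact: IH].
elim: N i j g => [|N IH] i j g g0 gc.
  have [/andP[i0 j0]|ij] := boolP ((i == 0%N) && (j == 0%N)).
    apply: le_trans (gc _ _).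
      by rewrite lee_fin ge_max ler01 (eqP i0) (eqP j0) !subr0 lexx.
    rewrite /counts (eqP i0) (eqP j0) !leq0n !andbT.
    by apply/forallP; case.
  rewrite (_ : Num.max _ _ = 0); first exact: g0.
  apply/max_idPl; rewrite /tail expr0.
  have e2 n : 1 <= 2 ^+ n.+1 * 1 :> R by rewrite mulr1 exprn_ege1// ler1n.
  by case: i j ij {gc} => [|i] [|j] //= _;
    [have := e2 j|have := e2 i|have := e2 j; have := e2 i]; lra.
rewrite /=.
(* Truncation at 0 keeps the levels nonnegative, as [E_ge] requires. *)
pose L i j := Num.max 0 (1 - tail N i - tail N j).
have Lpi : L i j <= L i.-1 j.
  by rewrite ge_max !le_max lexx/= lerD2r lerD2l lerN2 tail_pred orbT.
have Lpj : L i j <= L i j.-1.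
  by rewrite ge_max !le_max lexx/= lerD2l lerN2 tail_pred orbT.
apply: (@le_trans _ _
    (L i j + (L i.-1 j - L i j) * p + (L i j.-1 - L i j) * p)%:E).
  rewrite lee_fin; case/andP: p01 => p0 p12.
  have Lge i' j' : 0 <= L i' j' by rewrite le_max lexx.
  have LT i' j' : 1 - tail N i' - tail N j' <= L i' j' by rewrite le_max lexx orbT.
  rewrite ge_max; apply/andP; split.
    by rewrite !addr_ge0 ?mulr_ge0 ?subr_ge0.
  have := tail_step N i; have := tail_step N j.
  have h1 := ler_wpM2l p0 (LT i.-1 j).
  have h2 := ler_wpM2l p0 (LT i j.-1).
  have q0 : 0 <= 1 - 2 * p by lra.
  have h3 := ler_wpM2l q0 (LT i j).
  lra.
apply: E_ge => // [f||f Sf|f Af|f Bf].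
- exact: iter_ge0.
- by rewrite le_max lexx.
- apply: IH => // fs c; apply: gc.
  by apply: counts_vcons c => //; rewrite leq_addl.
- apply: IH => // fs c; apply: gc.
  by apply: counts_vcons c; rewrite ?AS ?leq_addl// Af; case: (i).
- apply: IH => // fs c; apply: gc.
  by apply: counts_vcons c; rewrite ?BS ?leq_addl// Bf; case: (j).
Qed.

Lemma iid_counts N k (g : ('I_N -> T) -> \bar R) : (0 < k)%N ->
  (forall fs, (0 <= g fs)%E) -> (forall fs, counts k k fs -> (1 <= g fs)%E) ->
  ((1 - 2 ^+ k.+1 * (1 - p / 2) ^+ N)%:E <= iter_int x0 E g)%E.
Proof.
move=> k0 g0 gc; apply: le_trans (iter_int_counts g0 gc).
rewrite lee_fin le_max /tail; case: k k0 {gc} => // k _.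
by rewrite [2 ^+ k.+2]exprS; apply/orP; right; lra.
Qed.

End TwoCounts.

(** By [2 <= e] and [1 - p / 2 <= e^(- p / 2)], the logarithm of the left side is at most
    [k + 1 - 2 (k + ln (1 / delta))], and [1 <= k]. *)
Lemma chernoff_le (R : realType) (p delta : R) (k N : nat) :
  (0 < k)%N -> 0 < delta < 1 -> 0 <= p <= 2^-1 ->
  p * N%:R = 4 * (k%:R + ln delta^-1) ->
  2 ^+ k.+1 * (1 - p / 2) ^+ N <= delta.
Proof.
move=> k0 /andP[d0 d1] /andP[p0 p1] pN.
have k1 : 1 <= k%:R :> R by rewrite ler1n.
have ld : 0 <= ln delta^-1 by rewrite ln_ge0// invf_ge1// ltW.
have e1 : 2 ^+ k.+1 <= expR k.+1%:R :> R.
  rewrite -[k.+1%:R]mulr1 expRM_natl ler_pXn2r// ?nnegrE ?expR_ge0//.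
  by have := @expR_ge1Dx R 1; lra.
have e2 : (1 - p / 2) ^+ N <= expR (- (p * N%:R / 2)).
  rewrite (_ : - (p * N%:R / 2) = N%:R * (- (p / 2))); last by ring.
  rewrite expRM_natl; apply: lerXn2r; rewrite ?nnegrE ?expR_ge0//; first by lra.
  by have := @expR_ge1Dx R (- (p / 2)); lra.
apply: (@le_trans _ _ (expR k.+1%:R * expR (- (p * N%:R / 2)))).
  by rewrite ler_pM// ?exprn_ge0//; lra.
rewrite -expRD -[leRHS](@lnK R) ?posrE// ler_expR.
by move: ld; rewrite lnV ?posrE// -(natr1 k) in pN * => ld; lra.
Qed.

(** * Entropy as a decreasing function of the margin *)

Section Entropy.
Context (R : realType).

Let S (s : R) : R := (1 + expR (- s))^-1.

Let S_gt0 s : 0 < S s.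
Proof. by rewrite invr_gt0 addr_gt0// expR_gt0. Qed.

Let S_opp s : S (- s) = 1 - S s.
Proof.
have e0 := expR_gt0 s; rewrite /S opprK expRN; field.
by apply/andP; split; lra.
Qed.

Let S_lt s s' : s < s' -> S s < S s'.
Proof.
move=> ss; rewrite ltf_pV2 ?posrE ?addr_gt0 ?expR_gt0//.
by rewrite ltrD2l ltr_expR ltrN2.
Qed.

Let H (q : R) := - (q * ln q) - (1 - q) * ln (1 - q).

Let ln_ltB1 (x : R) : 0 < x -> x != 1 -> ln x < x - 1.
Proof.
move=> x0 x1; have lx : ln x != 0.
  by apply: contra_neq x1 => l0; rewrite -(lnK (x := x)) ?posrE// l0 expR0.
by have := expR_gt1Dx lx; rewrite lnK ?posrE//; lra.
Qed.

(** Gibbs' inequality for the distributions [(p, 1 - p)] and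
    [(q, 1 - q)], the cross entropy being affine in [q]. *)
Let H_lt (p q : R) : 2^-1 <= p -> p < q -> q < 1 -> H q < H p.
Proof.
move=> p2 pq q1.
have p0 : 0 < p by lra.
have q0 : 0 < q by lra.
have p1' : 0 < 1 - p by lra.
have q1' : 0 < 1 - q by lra.
have g1 : q * (ln p - ln q) < p - q.
  rewrite -ln_div ?posrE//.
  have /ln_ltB1 h : 0 < p / q by rewrite divr_gt0.
  have : p / q != 1 by rewrite lt_eqF// ltr_pdivrMr// mul1r.
  move=> /h; rewrite -(ltr_pM2l q0); congr (_ < _).
  by field; rewrite gt_eqF.
have g2 : (1 - q) * (ln (1 - p) - ln (1 - q)) < q - p.
  rewrite -ln_div ?posrE//.
  have /ln_ltB1 h : 0 < (1 - p) / (1 - q) by rewrite divr_gt0.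
  have : (1 - p) / (1 - q) != 1 by rewrite gt_eqF// ltr_pdivlMr// mul1r; lra.
  move=> /h; rewrite -(ltr_pM2l q1'); congr (_ < _).
  by field; rewrite gt_eqF.
have pl : ln (1 - p) <= ln p by rewrite ler_ln ?posrE//; lra.
rewrite /H; nra.
Qed.

Variables (m : nat) (w : 'I_m -> R) (b t : R).
Hypothesis t0 : 0 < t.

(** The symmetries [S (- s) = 1 - S s] and [H q = H (1 - q)] make the entropy a function of
    [|zpre|], and [H] decreases strictly above one half. Low entropy therefore selects large
    margins. *)
Lemma entropy_lt (f g : 'I_m -> R) : `|zpre w b f| < `|zpre w b g| ->
  entropy w b t g < entropy w b t f.
Proof.
have eE h : entropy w b t h = H (S (t * `|zpre w b h|)).
  rewrite /entropy /p0hat /p1hat -/(S (t * zpre w b h)).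
  case: (leP 0 (zpre w b h)) => z; first by rewrite ger0_norm.
  by rewrite ltr0_norm// mulrN S_opp /H subKr; ring.
move=> fg; rewrite !eE; apply: H_lt.
- rewrite -[leLHS](_ : S 0 = 2^-1); last by rewrite /S oppr0 expR0.
  have [->|zN0] := eqVneq (t * `|zpre w b f|) 0; first by [].
  by apply/ltW/S_lt; rewrite lt_def zN0 mulr_ge0// ltW.
- by apply: S_lt; rewrite ltr_pM2l.
- by rewrite -subr_gt0 -S_opp.
Qed.

End Entropy.

(** * Contents of the memory and the nearest-neighbour rule *)

Section Memory.
Context (R : realType) (m : nat) (w : 'I_m -> R) (b t : R) (k N : nat).
Hypothesis t0 : 0 < t.
Variable fs : 'I_N -> ('I_m -> R).

(** Among the samples predicted [y], the one of least entropy, and of least index among those, has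
    no predecessor, so its rank is below [k]. *)
Lemma mem_neq0 y i0 : (0 < k)%N -> yhat w b (fs i0) = y ->
  exists j, Defs.in_mem w b t k fs y j.
Proof.
move=> k0 yi0; pose P i := yhat w b (fs i) == y.
have Pi0 : P i0 by rewrite /P yi0.
case: (Order.TotalTheory.arg_minP (fun i => entropy w b t (fs i)) Pi0) => i1 Pi1 min1.
pose Q i := P i && (entropy w b t (fs i) == entropy w b t (fs i1)).
have Qi1 : Q i1 by rewrite /Q Pi1 eqxx.
case: (fintype.arg_minnP (fun i => val i) Qi1) => j /andP[Pj /eqP ej] min2.
exists j; rewrite /Defs.in_mem; apply/andP; split; first exact: Pj.
rewrite eq_card0// => i; apply/negbTE/negP; rewrite in_setE /= => /andP[Pi].
rewrite ej => /orP[|/andP[ei ij]].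
  by rewrite ltNge min1.
by have := min2 i; rewrite /Q /P Pi ei leqNgt ij => /(_ isT).
Qed.

(** Otherwise the [k] or more samples in [A] would all have strictly smaller entropy than sample
    [j], pushing it out of the memory. *)
Lemma mem_extreme y j (A : ('I_m -> R) -> bool) (tau : R) :
  (forall f, A f -> yhat w b f = y /\ tau <= `|zpre w b f|) ->
  (k <= \sum_(i < N) A (fs i))%N ->
  Defs.in_mem w b t k fs y j -> tau <= `|zpre w b (fs j)|.
Proof.
move=> AP kA /andP[yj]; rewrite leNgt => rank; apply/negP => zj.
have : (k < k)%N; last by rewrite ltnn.
apply: leq_trans rank; rewrite ltnS; apply: leq_trans kA _.
rewrite -big_mkcond/= sum1_card; apply: subset_leq_card.
apply/fintype.subsetP => i; rewrite unfold_in => /AP[yi zi].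
by apply/mem_set; rewrite /= yi eqxx entropy_lt// (lt_le_trans zj).
Qed.

(** An error means that some memory element of the other class is at least as close to [f] as some
    element of class [y]; replacing both by their centers [c] costs [rho] twice. *)
Lemma h_post_dist (c : bool -> 'I_m -> R) (rho : R) (y : bool) f :
  (forall y, exists j, Defs.in_mem w b t k fs y j) ->
  (forall y j, Defs.in_mem w b t k fs y j -> Defs.edist (fs j) (c y) <= rho) ->
  h_post w b t k fs f <> y ->
  Defs.edist f (c (~~ y)) <= Defs.edist f (c y) + 2 * rho.
Proof.
move=> ex near hy.
suff [j [i [mj mi ij]]] : exists j i, [/\ Defs.in_mem w b t k fs y j,
    Defs.in_mem w b t k fs (~~ y) i & Defs.edist f (fs i) <= Defs.edist f (fs j)].
  have h1 := euclid_triangle f (c (~~ y)) (fs i).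
  have h2 := euclid_triangle f (fs j) (c y).
  have h3 := near _ _ mj; have h4 := near _ _ mi.
  rewrite (euclid_sym (fs j)) in h3; lra.
move: hy; case: y => hy.
  have [j mj] := ex true; exists j.
  apply: contrapT => /forallNP no; apply: hy.
  apply/existsP; exists j; rewrite mj/=; apply/forallP => i; apply/implyP => mi.
  by rewrite ltNge; apply/negP => le; apply: (no i).
have /existsP[i /andP[mi /forallP ij]] : h_post w b t k fs f.
  by move: hy; case: (h_post _ _ _ _ _ _).
have [j mj] := ex false; exists j, i; split => //.
by apply/ltW; move/implyP: (ij j); apply.
Qed.

End Memory.

(** * The sign symmetry between the two classes *)

Section Centers.
Context (R : realType) (m : nat).
Implicit Types u v f : 'I_m -> R.

Lemma center_true u : Defs.center u true = u.
Proof. by apply/funext => i; rewrite /Defs.center /=; ring. Qed.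

Lemma center_false u : Defs.center u false = fun i => - u i.
Proof. by apply/funext => i; rewrite /Defs.center /=; ring. Qed.

Lemma dotp_center2 u v y : dotp (Defs.center u y) (Defs.center v y) = dotp u v.
Proof.
by case: y; rewrite ?center_true// !center_false dotpNl dotpNr opprK.
Qed.

Lemma center_negb u y : Defs.center u (~~ y) = fun i => - Defs.center u y i.
Proof.
by case: y; rewrite /= center_true center_false//; apply/funext => i; rewrite opprK.
Qed.

Lemma centerD u v y :
  Defs.center (fun i => u i + v i) y = fun i => Defs.center u y i + Defs.center v y i.
Proof. by apply/funext => i; rewrite /Defs.center mulrDr. Qed.

End Centers.

(** * The adaptation model *)

Section Model.
Context (R : realType) (d : nat) (mu w : 'I_d -> R) (b t : R).
Hypotheses (w1 : dotp w w = 1) (t0 : 0 < t) (muw : 0 < dotp mu w).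
Hypotheses (b_gt : - dotp mu w - 1 < b) (b_lt : b < dotp mu w + 1).
Local Notation V := (vol_ball R d).
Local Notation v := (fun i => mu i + w i).

(** Over both balls [dotp f (center w y)] is at most [dotp mu w + 1], with
    equality only at [center v y]. *)
Definition near_apex r y (f : 'I_d -> R) :=
  cball (Defs.center mu y) f /\ dotp mu w + 1 - r ^+ 2 <= dotp f (Defs.center w y).

(** * Deterministic consequences of well-filled caps *)

Section Radius.
Variable r : R.
Hypotheses (r0 : 0 < r) (r12 : r <= 2^-1) (rmu : r <= dotp mu w).
Hypotheses (rb : r < dotp mu w + 1 + b) (rb' : r < dotp mu w + 1 - b).

Let r2r : r ^+ 2 <= r / 2.
Proof. by rewrite expr2 ler_wpM2l// ltW. Qed.

(** The margin [|zpre|] at height [r^2] below the apex; the bias enters with the sign of the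
    class. *)
Let tau y := if y then dotp mu w + 1 - r ^+ 2 + b else dotp mu w + 1 - r ^+ 2 - b.

Let margin y f : yhat w b f = y -> (tau y <= `|zpre w b f|) =
  (dotp mu w + 1 - r ^+ 2 <= dotp f (Defs.center w y)).
Proof.
rewrite /yhat; case: y => [z0|/negbT].
  by rewrite gtr0_norm// center_true lerD2r.
rewrite -leNgt => z0; rewrite ler0_norm// center_false dotpNr /tau /zpre.
by rewrite opprD lerD2r.
Qed.

Let apex_extreme y f : near_apex r y f ->
  yhat w b f = y /\ tau y <= `|zpre w b f|.
Proof.
move=> [_ fy]; have yf : yhat w b f = y.
  move: fy; rewrite /yhat /zpre; case: y; rewrite ?center_true ?center_false ?dotpNr => fy.
    by have [[]] := (r2r, rb, r0); lra.
  by apply/negbTE; rewrite -leNgt; have [[]] := (r2r, rb', r0); lra.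
by split=> //; rewrite margin.
Qed.

(** The opposite ball reaches only [1 - dotp mu w] in the direction of class [y], too low since
    [r <= dotp mu w]; so [f] is in the cap of its own ball, which has radius [sqrt 2 * r] about the
    apex. *)
Let extreme_dist y f :
  cball (Defs.center mu true) f \/ cball (Defs.center mu false) f ->
  yhat w b f = y -> tau y <= `|zpre w b f| ->
  Defs.edist f (Defs.center v y) <= 2 * r.
Proof.
move=> fS yf; rewrite margin// => fy.
have cwy : dotp (Defs.center w y) (Defs.center w y) = 1 by rewrite dotp_center2.
have fy' : cball (Defs.center mu y) f.
  have: cball (Defs.center mu y) f \/ cball (Defs.center mu (~~ y)) f.
    by case: {+}y fS => /=; tauto.
  case=> // /(cball_dotp_le cwy).
  by have [[]] := (r2r, rmu, r0); rewrite {1}center_negb dotpNl dotp_center2; lra.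
rewrite -(@ler_pXn2r _ 2)// ?nnegrE ?enorm_ge0 ?mulr_ge0// ?(ltW r0)//.
rewrite sqr_enorm centerD; apply: le_trans.
  apply: (@cball_sqr_dist _ _ _ _ _ (r ^+ 2) cwy fy').
  by rewrite dotp_center2.
by have := sqr_ge0 r; rewrite exprMn; lra.
Qed.

(** Let [D] be the distance from [f] to its apex [v_y]. An error gives [|f + v_y| <= D + 4 r];
    squaring and subtracting [D^2] leaves [4 dotp f v_y <= 8 r D + 16 r^2 <= 24 r], by [D <= 2] and
    [r^2 <= r / 2]. *)
Lemma h_post_err_dotp k N (fs : 'I_N -> ('I_d -> R))
    (A : bool -> ('I_d -> R) -> bool) :
  (0 < k)%N -> (forall y f, A y f -> near_apex r y f) ->
  (forall i, cball (Defs.center mu true) (fs i) \/ cball (Defs.center mu false) (fs i)) ->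
  (forall y, (k <= \sum_(i < N) A y (fs i))%N) ->
  forall y f, cball (Defs.center mu y) f -> h_post w b t k fs f <> y ->
  dotp f (Defs.center v y) <= 6 * r.
Proof.
move=> k0 Aapex fsS kA y f fy hy.
have ex y' : exists j, Defs.in_mem w b t k fs y' j.
  have [i Ai] : exists i, A y' (fs i).
    apply: contrapT => /forallNP no.
    have s0 : (\sum_(i < N) A y' (fs i) = 0)%N.
      by apply: big1 => i _; have /negP/negbTE -> := no i.
    by have := kA y'; rewrite s0 leqNgt k0.
  have [yi _] := apex_extreme (Aapex _ _ Ai).
  exact: mem_neq0 k0 yi.
have near y' j : Defs.in_mem w b t k fs y' j ->
    Defs.edist (fs j) (Defs.center v y') <= 2 * r.
  move=> mj; have yj : yhat w b (fs j) = y' by case/andP: mj => /eqP.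
  apply: extreme_dist => //.
  by apply: (mem_extreme t0 _ (kA y') mj) => g /Aapex/apex_extreme.
have := h_post_dist ex near hy; set D := Defs.edist f (Defs.center v y) => Dle.
have D2 : D <= 2.
  apply: le_trans (euclid_triangle _ _ (Defs.center mu y)) _.
  have h1 : Defs.edist f (Defs.center mu y) <= 1 by [].
  have h2 : Defs.edist (Defs.center mu y) (Defs.center v y) <= 1.
    rewrite -(@expr_le1 _ 2) ?enorm_ge0// sqr_enorm centerD.
    rewrite [X in dotp X X](_ : _ = fun i => - Defs.center w y i); last first.
      by apply/funext => i; ring.
    by rewrite dotpNl dotpNr opprK dotp_center2 w1.
  by rewrite -[2]/(1 + 1); lra.
have D0 : 0 <= D by exact: enorm_ge0.
have := Dle; rewrite -(@ler_pXn2r _ 2)// ?nnegrE ?enorm_ge0//; last first.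
  by rewrite addr_ge0// !mulr_ge0// ltW.
have DE : D ^+ 2 = dotp f f - 2 * dotp f (Defs.center v y) +
    dotp (Defs.center v y) (Defs.center v y) by rewrite sqr_enorm dotp_sqrB.
rewrite [X in X <= _]sqr_enorm dotp_sqrB center_negb dotpNr dotpNl dotpNr opprK.
rewrite [X in _ <= X](_ : _ = D ^+ 2 + 8 * r * D + 16 * r ^+ 2); last by ring.
rewrite DE; have := r2r; have : r * D <= r * 2 by rewrite ler_wpM2l// ltW.
lra.
Qed.

End Radius.

(** * Probability that both caps are well filled *)

Local Open Scope ereal_scope.

(** Each event is charged to its own ball, where it has mass at least [2 p]; the class weight one
    half reduces this to [p]. *)
Lemma marg_E_ge (S A B : ('I_d -> R) -> bool) (p pA pB : R)
    (q : ('I_d -> R) -> \bar R) (a a' c : R) :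
  (forall y f, cball (Defs.center mu y) f -> S f) ->
  (forall f, A f -> cball (Defs.center mu true) f) ->
  (forall f, B f -> cball (Defs.center mu false) f) ->
  leb_int (fun f => (A f)%:R%:E) = pA%:E ->
  leb_int (fun f => (B f)%:R%:E) = pB%:E ->
  (2 * p <= pA / V)%R -> (2 * p <= pB / V)%R ->
  (forall f, 0 <= q f) -> (0 <= c)%R -> (c <= a)%R -> (c <= a')%R ->
  (forall f, S f -> c%:E <= q f) -> (forall f, A f -> a%:E <= q f) ->
  (forall f, B f -> a'%:E <= q f) ->
  (c + (a - c) * p + (a' - c) * p)%:E <= marg_E mu q.
Proof.
move=> cS AS BS EA EB ppA ppB q0 c0 ca ca' qc qa qa'.
have hA : (c + (a - c) * (pA / V))%:E <= unif_ball_E (Defs.center mu true) q.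
  apply: (unif_ball_ge w1 q0 _ AS _ qa EA) => [|f /cS]; last exact: qc.
  by rewrite c0.
have hB : (c + (a' - c) * (pB / V))%:E <= unif_ball_E (Defs.center mu false) q.
  apply: (unif_ball_ge w1 q0 _ BS _ qa' EB) => [|f /cS]; last exact: qc.
  by rewrite c0.
apply: (@le_trans _ _ ((2^-1)%:E *
   ((c + (a' - c) * (pB / V))%:E + (c + (a - c) * (pA / V))%:E))).
  rewrite -EFinD -EFinM lee_fin.
  have h1 : ((a - c) * (2 * p) <= (a - c) * (pA / V))%R.
    by rewrite ler_wpM2l// subr_ge0.
  have h2 : ((a' - c) * (2 * p) <= (a' - c) * (pB / V))%R.
    by rewrite ler_wpM2l// subr_ge0.
  lra.
by apply: lee_wpmul2l; [rewrite lee_fin|exact: leeD].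
Qed.

Lemma h_post_err_dotp_prob : exists M r1 : R, [/\ (0 < M)%R, (0 < r1)%R &
  forall N k r (g : ('I_N -> ('I_d -> R)) -> \bar R), (0 < k)%N ->
  (0 < r <= r1)%R -> (forall fs, 0 <= g fs) ->
  (forall fs, (forall y f, cball (Defs.center mu y) f ->
      h_post w b t k fs f <> y -> (dotp f (Defs.center v y) <= 6 * r)%R) ->
    1 <= g fs) ->
  (0 <= r ^+ d.+1 / M <= 2^-1)%R /\
  (1 - 2 ^+ k.+1 * (1 - r ^+ d.+1 / M / 2) ^+ N)%:E <= iid_E mu g].
Proof.
have V0 := vol_ball_gt0 w1.
have cw1 y : dotp (Defs.center w y) (Defs.center w y) = 1%R by rewrite dotp_center2.
have [kT [rT [kT0 rT0 HT]]] := cap_volume (cw1 true).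
have [kF [rF [kF0 rF0 HF]]] := cap_volume (cw1 false).
pose k0 := Num.min kT kF.
have k00 : (0 < k0)%R by rewrite lt_min kT0.
(* Thus [r^(d+1) / M = k0 r^(d+1) / (2 V)] bounds from below the probability that a sample falls in
   a given cap. *)
pose M := (2 * V / k0)%R.
have M0 : (0 < M)%R by rewrite divr_gt0 ?mulr_gt0.
(* [rT] and [rF] are needed to inscribe the parallelepipeds, [M / 2] to have [p <= 1/2], and the
   last three to predict correctly in the caps and to separate the balls. *)
pose r1 := \big[Num.min/2^-1%R]_(x <- [:: rT; rF; (M / 2)%R; dotp mu w;
  ((dotp mu w + 1 + b) / 2)%R; ((dotp mu w + 1 - b) / 2)%R]) x.
have r1le : [/\ r1 <= 2^-1, r1 <= rT, r1 <= rF & r1 <= M / 2]%R /\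
    [/\ r1 <= dotp mu w, r1 <= (dotp mu w + 1 + b) / 2 &
        r1 <= (dotp mu w + 1 - b) / 2]%R.
  by rewrite /r1 !big_cons big_nil !ge_min !lexx !orbT.
have r10 : (0 < r1)%R.
  rewrite /r1 !big_cons big_nil !lt_min rT0 rF0 muw divr_gt0//=.
  by have := (b_gt, b_lt) => -[? ?]; apply/and3P; split=> //; lra.
clearbody r1; case: r1le => [[r1h r1T r1F r1M] [r1mu r1b r1b']].
exists M, r1; split=> // N k r g kp /andP[rp rr1] g0 gH.
have p01 : (0 <= r ^+ d.+1 / M <= 2^-1)%R.
  rewrite divr_ge0 ?exprn_ge0 ?(ltW rp) ?(ltW M0)//= ler_pdivrMr//.
  apply: (@le_trans _ _ r); last by lra.
  by rewrite exprS ler_piMr ?(ltW rp)// exprn_ile1 ?(ltW rp)//; lra.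
split=> //.
have [AT [ATc ATE]] := HT (Defs.center mu true) r (ltac:(by rewrite rp/= (le_trans rr1))).
have [AF [AFc AFE]] := HF (Defs.center mu false) r (ltac:(by rewrite rp/= (le_trans rr1))).
pose S f := `[< cball (Defs.center mu true) f \/ cball (Defs.center mu false) f >].
have pE : (2 * (r ^+ d.+1 / M) = k0 * r ^+ d.+1 / V)%R.
  by rewrite /M; field; rewrite !gt_eqF.
have rd0 : (0 <= r ^+ d.+1 / V)%R by rewrite divr_ge0 ?exprn_ge0// ltW.
apply: (@iid_counts _ _ _ _ S AT AF) => //.
- by move=> f /ATc[+ _]; move=> fc; apply/asboolP; left.
- by move=> f /AFc[+ _]; move=> fc; apply/asboolP; right.
- move=> q q0; apply: mule_ge0; first by rewrite lee_fin.
  by apply: adde_ge0; exact: (unif_ball_ge0 w1).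
- move=> q a a' c; apply: (marg_E_ge _ _ _ ATE AFE).
  + by move=> [] f fc; apply/asboolP; [left|right].
  + by move=> f /ATc[].
  + by move=> f /AFc[].
  + by rewrite pE -!mulrA ler_wpM2r// ge_min lexx.
  + by rewrite pE -!mulrA ler_wpM2r// ge_min lexx orbT.
move=> fs /and3P[/forallP fsS fT fF]; apply: gH.
apply: (@h_post_err_dotp r _ _ _ _ _ k N fs (fun y => if y then AT else AF)) => //.
- by lra.
- by lra.
- by lra.
- by lra.
- move=> y f Af; rewrite /near_apex -(dotp_center2 mu w y).
  by case: y Af => Af; [exact: (ATc _ Af)|exact: (AFc _ Af)].
- by move=> i; exact/asboolP/fsS.
- by case.
Qed.

Definition rate k (delta : R) N : R := ((k%:R + ln delta^-1) / N%:R)%R.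

Lemma rate_ge0 k delta N : (0 < delta < 1)%R -> (0 <= rate k delta N)%R.
Proof.
move=> /andP[d0 d1]; rewrite divr_ge0// addr_ge0// ln_ge0// invf_ge1// ltW//.
Qed.

Lemma h_post_err_dotp_whp : exists M : R, (0 < M)%R /\
  forall k delta, (0 < k)%N -> (0 < delta < 1)%R ->
  exists N0, forall N (P : set ('I_N -> ('I_d -> R))), (N0 <= N)%N ->
  (forall r fs, (0 <= r)%R -> (r ^+ d.+1 = M * rate k delta N)%R ->
    (forall y f, cball (Defs.center mu y) f ->
      h_post w b t k fs f <> y -> (dotp f (Defs.center v y) <= 6 * r)%R) ->
    P fs) ->
  (1 - delta)%:E <= iid_P mu P.
Proof.
have [M [r1 [M0 r10 H]]] := h_post_err_dotp_prob.
exists (4 * M)%R; split; first by rewrite mulr_gt0.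
move=> k delta k0 d01; have [d0 d1] := andP d01.
have ld : (0 <= ln delta^-1)%R by rewrite ln_ge0// invf_ge1// ltW.
set X := (k%:R + ln delta^-1)%R.
have X0 : (0 < X)%R by rewrite ltr_pwDl// ltr0n.
(* The value of [N] at which the radius chosen below equals [r1]; the radius makes [N p] equal to
   [4 (k + ln (1 / delta))], as the Chernoff estimate asks. *)
pose B := (4 * M * X / r1 ^+ d.+1)%R.
exists (Num.truncn B).+1 => N P NB HP.
have BN : (B < N%:R)%R by rewrite (lt_le_trans (truncnS_gt _))// ler_nat.
have N0 : (0 < N%:R :> R)%R by rewrite ltr0n (leq_trans _ NB).
pose r := ((4 * M * rate k delta N) `^ (d.+1%:R)^-1)%R.
have rt0 : (0 < rate k delta N)%R by rewrite divr_gt0.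
have MX0 : (0 < 4 * M * rate k delta N)%R by apply: mulr_gt0 => //; apply: mulr_gt0.
have r0 : (0 < r)%R by exact: powR_gt0.
have rE : (r ^+ d.+1 = 4 * M * rate k delta N)%R.
  rewrite -(powR_mulrn _ (ltW r0)) /r -powRrM mulVf ?pnatr_eq0// powRr1//.
  exact: ltW.
have rr1 : (r <= r1)%R.
  rewrite -(@ler_pXn2r _ d.+1)// ?nnegrE ?(ltW r0) ?(ltW r10)// rE /rate mulrA ler_pdivrMr//.
  by rewrite [leRHS]mulrC -ler_pdivrMr ?exprn_gt0// ltW.
have r01 : (0 < r <= r1)%R by rewrite r0.
have [||p01 bound] := H N k r (fun fs => (\1_P fs)%:E) k0 r01.
- by move=> fs; rewrite lee_fin indicE.
- by move=> fs fsP; rewrite indicE mem_set//; apply: HP fsP => //; exact: ltW.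
apply: le_trans bound; rewrite lee_fin lerD2l lerN2.
apply: chernoff_le => //; rewrite rE /rate -/X; field.
by rewrite !gt_eqF.
Qed.

(** * From confined errors to error rates *)

Let v_coord : exists i, v i != 0%R.
Proof.
apply: contrapT => /forallNP v0.
have : dotp v w = 0%R.
  by apply: big1 => i _; have /negP/negPn/eqP -> := v0 i; rewrite mul0r.
by rewrite dotpDl w1; have := muw; lra.
Qed.

Let v_gt0 : (0 < enorm v)%R.
Proof.
rewrite lt_def enorm_ge0 andbT; apply/eqP => v0.
by have [i] := v_coord; rewrite (enorm_eq0 v0) eqxx.
Qed.

Lemma err_le h h' (e : R) : (0 <= e)%R ->
  (forall y, unif_ball_E (Defs.center mu y) (fun f => (\1_[set f | h f != y] f)%:E) <=
     unif_ball_E (Defs.center mu y) (fun f => (\1_[set f | h' f != y] f)%:E) + e%:E) ->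
  err mu h <= err mu h' + e%:E.
Proof.
move=> e0 H; apply: (@le_trans _ _ ((2^-1)%:E *
  ((unif_ball_E (Defs.center mu false) (fun f => (\1_[set f | h' f != false] f)%:E) + e%:E) +
   (unif_ball_E (Defs.center mu true) (fun f => (\1_[set f | h' f != true] f)%:E) + e%:E)))).
  by apply: lee_wpmul2l; [rewrite lee_fin|apply: leeD; exact: H].
have U0 y : 0 <= unif_ball_E (Defs.center mu y) (fun f => (\1_[set f | h' f != y] f)%:E).
  by apply: (unif_ball_ge0 w1) => f; rewrite lee_fin indicE.
rewrite addeACA [X in X <= _]ge0_muleDr ?adde_ge0 ?U0 ?lee_fin//.
by rewrite /err leeD2l// -EFinD -EFinM lee_fin; lra.
Qed.

Lemma err_le_cst h (e : R) :
  (forall y, unif_ball_E (Defs.center mu y) (fun f => (\1_[set f | h f != y] f)%:E) <= e%:E) ->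
  err mu h <= e%:E.
Proof.
move=> H; apply: (@le_trans _ _ ((2^-1)%:E * (e%:E + e%:E))).
  by apply: lee_wpmul2l; [rewrite lee_fin|apply: leeD; exact: H].
by rewrite -EFinD -EFinM lee_fin; lra.
Qed.

Let indic01 (h : ('I_d -> R) -> bool) y f : 0 <= (\1_[set f | h f != y] f : R)%:E <= 1.
Proof. by rewrite indicE; case: (_ \in _); rewrite !lee_fin !lexx ler01. Qed.

Let h_asym_center y f : (dotp f (Defs.center v y) < 0)%R -> h_asym mu w f != y.
Proof.
rewrite /h_asym; case: y; rewrite ?center_true ?center_false ?dotpNr => fv.
  by rewrite ltNge (ltW fv).
by rewrite -oppr_lt0 fv.
Qed.

(** Outside the slab [|dotp f v| <= 6 r], an error of [h] forces [dotp f (center v y) < 0], hence an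
    error of [h_asym]. *)
Lemma eps_post_le_slab : exists K : R, (0 <= K)%R /\
  forall r (h : ('I_d -> R) -> bool), (0 <= r)%R ->
  (forall y f, cball (Defs.center mu y) f -> h f <> y ->
    (dotp f (Defs.center v y) <= 6 * r)%R) ->
  err mu h <= eps_asym mu w + (K * r)%:E.
Proof.
have [K [K0 H]] := unif_slab_le w1 v_coord.
exists (K * 6)%R; split; first by rewrite mulr_ge0.
move=> r h r0 hr; rewrite -mulrA; apply: err_le => [|y].
  by rewrite mulr_ge0// mulr_ge0.
apply: H => [|f|f|f fy fr]; first by rewrite mulr_ge0.
- by case/andP: (indic01 (h_asym mu w) y f).
- exact: indic01.
have [hf|hf] := eqVneq (h f) y.
  rewrite [X in X%:E <= _]indicE memNset; last by rewrite /= hf eqxx.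
  by case/andP: (indic01 (h_asym mu w) y f).
rewrite [X in _ <= X%:E]indicE mem_set/=; first by case/andP: (indic01 h y f).
apply: h_asym_center; have := hr y f fy (elimN eqP hf).
rewrite ltNge => fv; apply/negP => fv0.
move: fr; have -> : (`|dotp f v| = `|dotp f (Defs.center v y)|)%R.
  by case: {+}y; rewrite ?center_true// center_false dotpNr normrN.
by rewrite ger0_norm// ltNge fv.
Qed.

(** Otherwise the ball around [mu] crosses the hyperplane orthogonal to [v] to a depth [gam > 0],
    and a cap of height at most [gam] there has positive mass and is misclassified. *)
Lemma enorm_le_of_eps_asym0 : eps_asym mu w = 0 -> (enorm v <= dotp mu v)%R.
Proof.
move=> e0; rewrite leNgt; apply/negP => lt.
pose u i := (- (enorm v)^-1 * v i)%R.
have u1 : dotp u u = 1%R.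
  rewrite /u dotpZl dotpZr -sqr_enorm; field; exact: lt0r_neq0.
have [kappa [r0 [kappa0 r00 H]]] := cap_volume u1.
pose gam := (1 - dotp mu v / enorm v)%R.
have gam0 : (0 < gam)%R by rewrite subr_gt0 ltr_pdivrMr// mul1r.
pose r := Num.min r0 (Num.min 1 gam)%R.
have [r_r0 [r_1 r_gam]] : [/\ r <= r0, r <= 1 & r <= gam]%R.
  by rewrite /r !ge_min !lexx !orbT.
have rp : (0 < r)%R by rewrite !lt_min r00 gam0 ltr01.
have [A [AP AE]] := H mu r (ltac:(by rewrite rp)).
have r2 : (r ^+ 2 <= gam)%R.
  by apply: le_trans r_gam; rewrite expr2 ler_piMr// ltW.
have Aerr f : A f -> h_asym mu w f != true.
  move=> /AP[_]; rewrite /u !dotpZr => fA.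
  rewrite /h_asym eqb_id -leNgt.
  have : (- (enorm v)^-1 * dotp f v >= 0)%R.
    apply: le_trans fA; rewrite mulNr mulrC.
    by move: r2; rewrite /gam; lra.
  by rewrite mulNr oppr_ge0 pmulr_rle0// invr_gt0.
have := unif_ball_ge w1 (g := fun f => (\1_[set f | h_asym mu w f != true] f)%:E)
  (k0 := 0%R) (a := 1%R) _ _ (fun f fA => (AP f fA).1) _ _ AE.
have i0 y f : 0 <= (\1_[set f | h_asym mu w f != y] f : R)%:E.
  by case/andP: (indic01 (h_asym mu w) y f).
move=> /(_ (i0 true)); rewrite lexx ler01 => /(_ isT (fun f _ => i0 true f)).
have A1 f : A f -> 1%:E <= (\1_[set f | h_asym mu w f != true] f : R)%:E.
  by move=> fA; rewrite indicE mem_set//; exact: Aerr.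
move=> /(_ A1); rewrite add0r subr0 mul1r => low.
have pos : (0 < kappa * r ^+ d.+1 / V)%R.
  by rewrite divr_gt0 ?(vol_ball_gt0 w1)// mulr_gt0// exprn_gt0.
have : 0 < eps_asym mu w; last by rewrite e0 ltxx.
rewrite /eps_asym /err mule_gt0// ?lte_fin//.
rewrite (lt_le_trans (y := unif_ball_E (Defs.center mu true)
  (fun f => (\1_[set f | h_asym mu w f != true] f)%:E)))//.
  by rewrite center_true; apply: lt_le_trans low; rewrite lte_fin.
by rewrite leeDr//; apply: (unif_ball_ge0 w1) => f; exact: i0.
Qed.

(** Both balls now lie on the correct side of the hyperplane, so [dotp f (center v y) <= 6 r]
    confines errors to a cap of height [6 r / |v|] in direction [- center v y / |v|]. *)
Lemma eps_post_le_cap : eps_asym mu w = 0 -> exists K : R, (0 <= K)%R /\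
  forall r (h : ('I_d -> R) -> bool), (0 <= r)%R ->
  (forall y f, cball (Defs.center mu y) f -> h f <> y ->
    (dotp f (Defs.center v y) <= 6 * r)%R) ->
  err mu h <= (K * Num.sqrt r ^+ d.+1)%:E.
Proof.
move=> /enorm_le_of_eps_asym0 vmu.
pose u y i := (- (enorm v)^-1 * Defs.center v y i)%R.
have u1 y : dotp (u y) (u y) = 1%R.
  rewrite /u dotpZl dotpZr dotp_center2 -sqr_enorm; field; exact: lt0r_neq0.
have [KT [KT0 HT]] := unif_cap_le (u1 true).
have [KF [KF0 HF]] := unif_cap_le (u1 false).
pose a := Num.sqrt (6 / enorm v)%R.
have a0 : (0 <= a)%R by exact: sqrtr_ge0.
exists ((KT + KF) * a ^+ d.+1)%R; split.
  by rewrite mulr_ge0 ?addr_ge0 ?exprn_ge0.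
move=> r h r0 hr; apply: err_le_cst => y.
have s0 : (0 <= 6 / enorm v * r)%R by rewrite mulr_ge0// divr_ge0// enorm_ge0.
have [K [K0 KTF H]] : exists K : R, [/\ (0 <= K)%R, (K <= KT + KF)%R &
  forall (c : 'I_d -> R) (s : R) (g : ('I_d -> R) -> \bar R),
  (0 <= s)%R -> (forall f, 0 <= g f <= 1) ->
  (forall f, cball c f -> (dotp f (u y) < dotp c (u y) + 1 - s)%R -> g f = 0) ->
  unif_ball_E c g <= (K * Num.sqrt s ^+ d.+1)%:E].
  by case: y; [exists KT|exists KF]; split=> //; rewrite ?lerDl ?lerDr.
apply: le_trans (H (Defs.center mu y) _ _ s0 (indic01 h y) _) _.
  have uE g : (dotp g (u y) = - (enorm v)^-1 * dotp g (Defs.center v y))%R.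
    exact: dotpZr.
  move=> f fy; rewrite !uE dotp_center2 => fu.
  have [hf|hf] := eqVneq (h f) y; first by rewrite indicE memNset//= hf eqxx.
  have fv := hr y f fy (elimN eqP hf).
  move: fu; rewrite ltNge => /negP; case.
  have h1 : (1 <= (enorm v)^-1 * dotp mu v)%R.
    by rewrite mulrC ler_pdivlMr// mul1r.
  have h2 : ((enorm v)^-1 * dotp f (Defs.center v y) <= (enorm v)^-1 * (6 * r))%R.
    by rewrite ler_wpM2l// invr_ge0 enorm_ge0.
  lra.
rewrite lee_fin sqrtrM ?divr_ge0 ?enorm_ge0// exprMn mulrA.
by apply: ler_wpM2r; rewrite ?exprn_ge0 ?sqrtr_ge0// ler_wpM2r ?exprn_ge0.
Qed.

End Model.

(** * The two convergence rates *)

Unset Implicit Arguments.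
Set Strict Implicit.

Theorem theorem1 (R : realType) (d : nat) (hd : (1 <= d)%N)
  (mu w : 'I_d -> R) (hw : enorm w = 1) (b t : R) (ht : 0 < t)
  (hpre1 : 0 < dotp mu w)
  (hpre2 : - dotp mu w - 1 < b) (hpre3 : b < dotp mu w + 1) :
  (exists C : R,
    forall (k : nat), (0 < k)%N -> forall delta : R, 0 < delta < 1 ->
    exists N0 : nat, forall N : nat, (N0 <= N)%N ->
      (iid_P mu
        [set fs : 'I_N -> ('I_d -> R) |
          (eps_post mu w b t k fs <=
           eps_asym mu w +
           (C * ((k%:R + ln delta^-1) / N%:R) `^ (d.+1%:R)^-1)%:E)%E]
       >= (1 - delta)%:E)%E)
  /\
  (eps_asym mu w = 0%E ->
   exists C : R,
    forall (k : nat), (0 < k)%N -> forall delta : R, 0 < delta < 1 ->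
    exists N0 : nat, forall N : nat, (N0 <= N)%N ->
      (iid_P mu
        [set fs : 'I_N -> ('I_d -> R) |
          (eps_post mu w b t k fs <=
           (C * ((k%:R + ln delta^-1) / N%:R) `^ (2^-1))%:E)%E]
       >= (1 - delta)%:E)%E).
Proof.
have w1 : dotp w w = 1 by rewrite -sqr_enorm hw expr1n.
have [M [M0 H]] := h_post_err_dotp_whp w1 ht hpre1 hpre2 hpre3.
split.
  have [K [K0 KH]] := eps_post_le_slab w1 hpre1.
  (* From [r^(d+1) = M * rate], the slab bound [K r] is [K] times the [(d+1)]-st root of
     [M * rate]. *)
  exists (K * M `^ (d.+1%:R)^-1) => k k0 delta d01.
  have [N0 HN] := H k delta k0 d01; exists N0 => N NN0.
  apply: HN => // r fs r0 rE /(KH _ _ r0) /le_trans; apply.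
  apply: leeD2l; rewrite lee_fin -mulrA -powRM ?(ltW M0) ?rate_ge0//.
  by rewrite -rE -powR_mulrn// -powRrM mulfV ?pnatr_eq0// powRr1.
move=> /(eps_post_le_cap w1 hpre1)[K [K0 KH]].
(* Here [(sqrt r)^(d+1) = sqrt (r^(d+1)) = sqrt (M * rate)]: the dimension cancels and leaves the
   exponent one half. *)
exists (K * Num.sqrt M) => k k0 delta d01.
have [N0 HN] := H k delta k0 d01; exists N0 => N NN0.
apply: HN => // r fs r0 rE /(KH _ _ r0) /le_trans; apply.
rewrite lee_fin -mulrA powR12_sqrt ?rate_ge0// -sqrtrM ?(ltW M0)// -rE.
rewrite ler_wpM2l// -{2}(sqr_sqrtr r0) exprAC sqrtr_sqr ger0_norm//.
Qed.
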